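(* If an $n\times n$ matrix function $G$ on $\mathbb{R}$ admits a bounded canonical factorization, then for any non-trivial solution $(\phi_+,\phi_-)$ of the problem $G\phi_+=\phi_-$, $\phi_\pm\in(H_\infty^\pm)^n$, one has in fact $\phi_+\in CP^+$ and $\phi_-\in CP^-$.
   Context: $H_\infty^\pm$ is the Hardy class of bounded analytic functions in $\mathbb{C}^\pm=\{z:\pm\mathrm{Im}\, z>0\}$, identified with boundary values on $\mathbb{R}$. A bounded canonical factorization of $G$ is a representation $G=G_-G_+^{-1}$ on $\mathbb{R}$ with $G_+^{\pm1}\in(H_\infty^+)^{n\times n}$ and $G_-^{\pm1}\in(H_\infty^-)^{n\times n}$. A vector $\omega=(\omega_1,\ldots,\omega_n)\in(H_\infty^\pm)^n$ satisfies the corona condition in $\mathbb{C}^\pm$, written $\omega\in CP^\pm$, if $\inf_{z\in\mathbb{C}^\pm}(|\omega_1(z)|+\cdots+|\omega_n(z)|)>0$. *)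

(* Defs.v *)
From HB Require Import structures.
From mathcomp Require Import all_boot all_order all_algebra.
From mathcomp Require Import all_classical all_reals all_analysis.
From mathcomp.real_closed Require Import complex.

Set Implicit Arguments.
Unset Strict Implicit.
Unset Printing Implicit Defensive.

Import Order.TTheory GRing.Theory Num.Theory numFieldNormedType.Exports.

Local Open Scope classical_set_scope.
Local Open Scope complex_scope.
Local Open Scope ring_scope.

Definition upper_half_plane (R : realType) : set R[i] :=
  [set z | 0 < complex.Im z].

Definition lower_half_plane (R : realType) : set R[i] :=
  [set z | complex.Im z < 0].

(* Functions on a half-plane D are represented by total functions on R[i];
   their values outside D are never used. R[i]^o carries the topology and the
   normed-module structure over the field R[i], so that derivability at z in
   direction 1 is complex differentiability at z. *)
Definition Hinf (R : realType) (D : set R[i]) : set (R[i] -> R[i]) :=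
  [set F | (forall z, D z -> derivable (F : R[i]^o -> R[i]^o) z 1) /\
           [bounded (F z : R[i]^o) | z in D]].

Definition Hinf_mx (R : realType) (D : set R[i]) (m n : nat) :
    set (R[i] -> 'M[R[i]]_(m, n)) :=
  [set Phi | forall i j, Hinf D (fun z => Phi z i j)].

Definition stolz_sector (R : realType) (D : set R[i]) (x a : R) : set R[i] :=
  [set z | D z /\ `|complex.Re z - x| < a * `|complex.Im z| ].

(* l is the boundary value of F at the real point x, i.e. its nontangential
   limit from D *)
Definition boundary_value (R : realType) (D : set R[i]) (F : R[i] -> R[i])
    (x : R) (l : R[i]) : Prop :=
  forall a : R, 0 < a ->
    F z @[z --> within (stolz_sector D x a) (nbhs (x%:C : R[i]^o))]
      --> (l : R[i]^o).

Definition boundary_value_mx (R : realType) (D : set R[i]) (m n : nat)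
    (Phi : R[i] -> 'M[R[i]]_(m, n)) (x : R) (A : 'M[R[i]]_(m, n)) : Prop :=
  forall i j, boundary_value D (fun z => Phi z i j) x (A i j).

(* An element of H_oo^{+-} is identified with its boundary values, which exist
   at almost every point of the real line (Fatou); an equation "on R" holds
   when, at almost every x, the boundary values exist and satisfy it.
   G_+^{-1} is the pointwise inverse in the half-plane, and the matrix B below
   is the boundary value of that element of H_oo^+. *)
Definition bounded_canonical_factorization (R : realType) (n : nat)
    (G : R -> 'M[R[i]]_n) (Gm Gp : R[i] -> 'M[R[i]]_n) : Prop :=
  [/\ [/\ forall z, upper_half_plane z -> Gp z \in unitmx,
          Hinf_mx (@upper_half_plane R) Gp
        & Hinf_mx (@upper_half_plane R) (fun z => invmx (Gp z))],
      [/\ forall z, lower_half_plane z -> Gm z \in unitmx,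
          Hinf_mx (@lower_half_plane R) Gm
        & Hinf_mx (@lower_half_plane R) (fun z => invmx (Gm z))]
    & {ae @lebesgue_measure R, forall x, exists A B : 'M[R[i]]_n,
        [/\ boundary_value_mx (@lower_half_plane R) Gm x A,
            boundary_value_mx (@upper_half_plane R)
              (fun z => invmx (Gp z)) x B
          & G x = A *m B]}].

Definition admits_bounded_canonical_factorization (R : realType) (n : nat)
    (G : R -> 'M[R[i]]_n) : Prop :=
  exists Gm Gp : R[i] -> 'M[R[i]]_n, bounded_canonical_factorization G Gm Gp.

Definition RH_solution (R : realType) (n : nat) (G : R -> 'M[R[i]]_n)
    (phip phim : R[i] -> 'cV[R[i]]_n) : Prop :=
  [/\ Hinf_mx (@upper_half_plane R) phip,
      Hinf_mx (@lower_half_plane R) phim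
    & {ae @lebesgue_measure R, forall x, exists u v : 'cV[R[i]]_n,
        [/\ boundary_value_mx (@upper_half_plane R) phip x u,
            boundary_value_mx (@lower_half_plane R) phim x v
          & G x *m u = v]}].

Definition trivial_solution (R : realType) (n : nat)
    (phip phim : R[i] -> 'cV[R[i]]_n) : Prop :=
  (forall z, upper_half_plane z -> phip z = 0) /\
  (forall z, lower_half_plane z -> phim z = 0).

Definition corona (R : realType) (D : set R[i]) (n : nat)
    (w : R[i] -> 'cV[R[i]]_n) : Prop :=
  0 < inf [set \sum_(i < n) ComplexField.Normc.normc (w z i 0) | z in D].

(* Main.v *)
Require Import Defs.
From mathcomp Require Import all_boot all_order all_algebra.
From mathcomp Require Import all_classical all_reals all_analysis.
From mathcomp Require Import measurable_realfun.
From mathcomp.real_closed Require Import complex.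
From mathcomp Require Import ring lra.

(** Let [G = Gm * Gp^-1] on the real line. The equation [G * phip = phim] says
    that [Gp^-1 * phip], bounded and analytic in the upper half-plane, and
    [Gm^-1 * phim], bounded and analytic in the lower one, have the same boundary
    values almost everywhere. Two such functions are one and the same constant
    vector [c] ([glued_boundary_const]). Hence [phip = Gp * c] and
    [phim = Gm * c], so [c] is nonzero for a non-trivial solution, and as
    [Gp^-1] and [Gm^-1] are bounded, [c] bounds [phip] and [phim] away from 0
    ([corona_of_linear]).

    The core is thus a Liouville theorem for a scalar bounded function [h],
    holomorphic off the real line, whose jump across the line vanishes almost
    everywhere. The proof goes from bare complex differentiability to
    [h' = 0] without passing through Cauchy's formula or power series.
    Goursat's lemma ([goursat]) shows that the integral of a decaying
    holomorphic function along a horizontal line does not change when the line is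
    shifted. Applied to [h(z) / (z - w)^2], with dominated convergence both at
    infinity and at the real line, where the vanishing jump lets the contour
    cross, it gives integral 0 along every horizontal line that avoids the real
    line and [w], on whichever side [w] lies ([integral_ker2]). For a point [p]
    of the line, subtracting the cases [w = p - i s] and [w = p + i s] shows that
    the increments of [h] at [p] are orthogonal to
    [t / (t^2 + s^2)^2] for every small [s]; letting [s] tend to 0 forces the
    derivative at [p] to vanish ([glued_deriv0]). So [h] is constant in each
    half-plane, and the boundary values identify the two constants. *)

Set Implicit Arguments.
Unset Strict Implicit.
Unset Printing Implicit Defensive.

Import Order.TTheory GRing.Theory Num.Theory numFieldNormedType.Exports.

Local Open Scope classical_set_scope.
Local Open Scope complex_scope.
Local Open Scope ring_scope.

(** * Goursat's bisection *)

Section bisection.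
Context {R : realType}.
Variable F : R -> R -> R -> R -> R.
Variables a0 b0 c0 d0 : R.

Definition subrect a b c d :=
  [/\ a0 <= a, a <= b, b <= b0, c0 <= c & c <= d] /\ d <= d0.

Hypothesis splitx : forall a m b c d, subrect a b c d -> a <= m <= b ->
  F a b c d = F a m c d + F m b c d.
Hypothesis splity : forall a b c m d, subrect a b c d -> c <= m <= d ->
  F a b c d = F a b c m + F a b m d.
Hypothesis local : forall x y, a0 <= x <= b0 -> c0 <= y <= d0 ->
  forall e, 0 < e -> exists2 dl, 0 < dl & forall a b c d, subrect a b c d ->
    a <= x <= b -> c <= y <= d -> b - a < dl -> d - c < dl ->
    `|F a b c d| <= e * ((b - a) + (d - c)) ^+ 2.

Let bad eta (r : R * R * R * R) :=
  let: (a, b, c, d) := r in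
  subrect a b c d /\ eta * ((b - a) + (d - c)) ^+ 2 < `|F a b c d|.

Let half (r s : R * R * R * R) :=
  let: (a, b, c, d) := r in let: (a', b', c', d') := s in
  [/\ a <= a', b' <= b, c <= c' & d' <= d] /\
  b' - a' = (b - a) / 2 /\ d' - c' = (d - c) / 2.

Let bad_half eta r : bad eta r -> exists2 s, bad eta s & half r s.
Proof.
case: r => [[[a b] c] d] /= [[[h1 h2 h3 h4 h5] h6] lt].
pose m := (a + b) / 2; pose k := (c + d) / 2.
have am : a <= m <= b by rewrite /m; apply/andP; split; lra.
have ck : c <= k <= d by rewrite /k; apply/andP; split; lra.
have [/andP[am1 am2] /andP[ck1 ck2]] := (am, ck).
have sub : subrect a b c d by [].
have subl : subrect a m c d by split=> //; split=> //; lra.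
have subr : subrect m b c d by split=> //; split=> //; lra.
have E : F a b c d = F a m c k + F a m k d + (F m b c k + F m b k d).
  by rewrite (splitx sub am) (splity subl ck) (splity subr ck).
pose q := eta * ((b - a) / 2 + (d - c) / 2) ^+ 2.
have D4 : eta * ((b - a) + (d - c)) ^+ 2 = 4 * q by rewrite /q; field.
have pick a' b' c' d' : subrect a' b' c' d' ->
    half (a, b, c, d) (a', b', c', d') -> q < `|F a' b' c' d'| ->
    exists2 s, bad eta s & half (a, b, c, d) s.
  move=> s' hs' lt'; exists (a', b', c', d') => //; split=> //.
  by have [_ [-> ->]] := hs'.
have [/pick|l1] := ltP q `|F a m c k|.
  by apply; rewrite /m /k; do !split => //; lra.
have [/pick|l2] := ltP q `|F a m k d|.
  by apply; rewrite /m /k; do !split => //; lra.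
have [/pick|l3] := ltP q `|F m b c k|.
  by apply; rewrite /m /k; do !split => //; lra.
have [/pick|l4] := ltP q `|F m b k d|.
  by apply; rewrite /m /k; do !split => //; lra.
exfalso; move: lt; rewrite D4 E ltNge => /negP; apply.
have := ler_normD (F a m c k + F a m k d) (F m b c k + F m b k d).
have := ler_normD (F a m c k) (F a m k d).
have := ler_normD (F m b c k) (F m b k d).
lra.
Qed.

(** If the value on the whole rectangle were nonzero, some quarter would carry
    at least a quarter of it; the nested rectangles obtained in this way shrink
    to a point, where [local] says that the value is much smaller than the
    square of the diameter. *)
Lemma bisection0 : a0 <= b0 -> c0 <= d0 -> F a0 b0 c0 d0 = 0.
Proof.
move=> ab0 cd0; apply/eqP/negPn/negP => F0.
have sub0 : subrect a0 b0 c0 d0 by do !split.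
(* The + 1 keeps the denominator positive for a degenerate rectangle and makes
   the inequality defining [bad] strict. *)
pose eta := `|F a0 b0 c0 d0| / (((b0 - a0) + (d0 - c0)) ^+ 2 + 1).
have D0 : 0 < ((b0 - a0) + (d0 - c0)) ^+ 2 + 1 by rewrite ltr_wpDl ?sqr_ge0.
have eta0 : 0 < eta by rewrite divr_gt0 ?normr_gt0.
have bad0 : bad eta (a0, b0, c0, d0).
  split=> //; rewrite /eta mulrAC ltr_pdivrMr// ltr_pM2l ?normr_gt0//.
  by rewrite ltrDl.
have [f fP] : {f : _ -> _ & forall r, bad eta r -> bad eta (f r) /\ half r (f r)}.
  apply: (@choice _ _ (fun r s => bad eta r -> bad eta s /\ half r s)) => r.
  have [/bad_half[s bs hs]|nb] := pselect (bad eta r); first by exists s.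
  by exists r.
pose r n := iter n f (a0, b0, c0, d0).
have rbad n : bad eta (r n) by elim: n => [|n /fP[]].
have rhalf n : half (r n) (r n.+1) by have [] := fP _ (rbad n).
pose A n := (r n).1.1.1; pose B n := (r n).1.1.2.
pose C n := (r n).1.2; pose D n := (r n).2.
have rE n : r n = (A n, B n, C n, D n) by rewrite /A /B /C /D; case: (r n) => [[[]]].
have badn n : bad eta (A n, B n, C n, D n) by rewrite -rE.
have halfn n : half (A n, B n, C n, D n) (A n.+1, B n.+1, C n.+1, D n.+1).
  by rewrite -!rE.
have mono n k : [/\ A n <= A (n + k)%N, B (n + k)%N <= B n, C n <= C (n + k)%N
    & D (n + k)%N <= D n].
  elim: k => [|k [i1 i2 i3 i4]]; first by rewrite addn0.
  rewrite addnS; have [[j1 j2 j3 j4] _] := halfn (n + k)%N.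
  by split; [exact: le_trans j1|exact: le_trans i2|exact: le_trans j3|exact: le_trans i4].
have ord n : A n <= B n /\ C n <= D n by have [[[]]] := badn n.
have AB n m : A n <= B m.
  have [i _ _ _] := mono n m; have [_ j _ _] := mono m n.
  by apply: (le_trans i); apply: le_trans j; rewrite addnC; have [] := ord (m + n)%N.
have CD n m : C n <= D m.
  have [_ _ i _] := mono n m; have [_ _ _ j] := mono m n.
  by apply: (le_trans i); apply: le_trans j; rewrite addnC; have [] := ord (m + n)%N.
pose x := sup (range A); pose y := sup (range C).
have xA n : A n <= x.
  by apply: ub_le_sup; [exists (B 0%N) => _ [k _ <-]|exists n].
have xB n : x <= B n.
  by apply: ge_sup; [exists (A 0%N), 0%N|move=> _ [k _ <-]].
have yC n : C n <= y.
  by apply: ub_le_sup; [exists (D 0%N) => _ [k _ <-]|exists n].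
have yD n : y <= D n.
  by apply: ge_sup; [exists (C 0%N), 0%N|move=> _ [k _ <-]].
have [||dl dl0 dlP] := @local x y _ _ eta eta0.
- by rewrite (xA 0%N) (xB 0%N).
- by rewrite (yC 0%N) (yD 0%N).
have width n : B n - A n = (b0 - a0) / 2 ^+ n /\ D n - C n = (d0 - c0) / 2 ^+ n.
  elim: n => [|n [i1 i2]]; first by rewrite expr0 !divr1.
  have [_ [-> ->]] := halfn n; rewrite i1 i2 exprS.
  by split; rewrite invfM mulrA mulrAC.
have small (e : R) : 0 <= e -> exists N, forall n, (N <= n)%N -> e / 2 ^+ n < dl.
  move=> e0.
  have : (fun n => e * 2^-1 ^+ n) @ \oo --> (e * 0).
    by apply: cvgMr; apply: cvg_expr; rewrite gtr0_norm ?invf_lt1 ?ltr1n.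
  rewrite mulr0 => /cvgr0Pnorm_lt/(_ dl dl0)[N _ NP].
  exists N => n Nn; have := NP n Nn; rewrite /= exprVn ger0_norm//.
  by rewrite divr_ge0// exprn_ge0.
have [N1 N1P] := small (b0 - a0) ltac:(lra).
have [N2 N2P] := small (d0 - c0) ltac:(lra).
pose n := maxn N1 N2.
have [subn] := badn n; apply/negP; rewrite -leNgt.
have [w1 w2] := width n.
apply: dlP => //.
- by rewrite xA xB.
- by rewrite yC yD.
- by rewrite w1 N1P// leq_maxl.
- by rewrite w2 N2P// leq_maxr.
Qed.
End bisection.

(** * Goursat's lemma for a pair of real functions *)

Section segments.
Context {R : realType}.
Local Notation mu := (@lebesgue_measure R).
Implicit Types (g : R -> R) (a b c d : R).

Definition seg_int g a b : R := \int[mu]_(x in `[a, b]) g x.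

Definition cont_on g a b := forall x, a <= x <= b -> {for x, continuous g}.

Lemma seg_integrable g a b : cont_on g a b ->
  mu.-integrable `[a, b] (EFin \o g).
Proof.
move=> cg; apply: continuous_compact_integrable; first exact: segment_compact.
apply: continuous_in_subspaceT => x /set_mem/=; rewrite in_itv/=; exact: cg.
Qed.

Lemma seg_int_chasles g a m b : a <= m <= b -> cont_on g a b ->
  seg_int g a b = seg_int g a m + seg_int g m b.
Proof.
move=> /andP[am mb] /seg_integrable ig; rewrite /seg_int.
apply/eqP; rewrite addrC -subr_eq; apply/eqP.
rewrite Rintegral_itvB ?bnd_simp//.
rewrite Rintegral_itv_obnd_cbnd//.
by apply: integrableS ig => //; apply: subset_itvr; rewrite bnd_simp.
Qed.

Lemma seg_intD g1 g2 a b : cont_on g1 a b -> cont_on g2 a b ->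
  seg_int (fun x => g1 x + g2 x) a b = seg_int g1 a b + seg_int g2 a b.
Proof. by move=> c1 c2; rewrite /seg_int RintegralD//; exact: seg_integrable. Qed.

Lemma seg_int_cst k a b : a <= b -> seg_int (fun=> k) a b = k * (b - a).
Proof.
move=> ab; rewrite /seg_int Rintegral_cst//= lebesgue_measure_itv/= lte_fin.
by case: ltP => ba; rewrite ?EFinB//= (_ : a = b) ?subrr ?mulr0//; apply/eqP; rewrite eq_le ab.
Qed.

Lemma seg_int_approx g k e a b : a <= b -> cont_on g a b ->
  (forall x, a <= x <= b -> `|g x - k| <= e) ->
  `|seg_int g a b - k * (b - a)| <= e * (b - a).
Proof.
move=> ab cg ge.
have ck (r : R) : cont_on (fun=> r) a b by move=> x _; exact: cvg_cst.
have intk (r : R) : mu.-integrable `[a, b] (EFin \o (fun=> r)).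
  exact: seg_integrable.
have ig := seg_integrable cg.
have up : seg_int g a b <= (k + e) * (b - a).
  rewrite -seg_int_cst//; apply: le_Rintegral => // x/=; rewrite in_itv/= => /ge.
  by rewrite ler_norml => /andP[]; lra.
have lo : (k - e) * (b - a) <= seg_int g a b.
  rewrite -seg_int_cst//; apply: le_Rintegral => // x/=; rewrite in_itv/= => /ge.
  by rewrite ler_norml => /andP[]; lra.
by rewrite ler_norml; apply/andP; split; lra.
Qed.
End segments.

Section Goursat.
Context {R : realType}.
Implicit Types (P Q : R -> R -> R).

(** Frechet differentiability of a function of two real variables, with partial
    derivatives [A] and [B]. The error is measured with the l1 norm. *)
Definition rdiff P x0 y0 A B := forall e : R, 0 < e -> exists2 dl : R, 0 < dl &
  forall x y, `|x - x0| < dl -> `|y - y0| < dl ->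
  `|P x y - P x0 y0 - A * (x - x0) - B * (y - y0)| <= e * (`|x - x0| + `|y - y0|).

Lemma rdiff_contx P x0 y0 A B : rdiff P x0 y0 A B ->
  {for x0, continuous (P ^~ y0)}.
Proof.
move=> /(_ 1 ltr01)[dl dl0 H]; apply/cvgrPdist_lt => e e0.
have k0 : 0 < `|A| + 1 by rewrite ltr_wpDl.
apply/nbhs_ballP; exists (Num.min dl (e / (`|A| + 1))) => /=.
  by rewrite lt_min dl0 divr_gt0.
move=> x; rewrite /ball/= lt_min distrC => /andP[xd xe].
have := H x y0 xd; rewrite !subrr normr0 mulr0 subr0 addr0 mul1r => /(_ dl0) H1.
rewrite distrC (_ : P x y0 - _ = (P x y0 - P x0 y0 - A * (x - x0)) + A * (x - x0)); last by ring.
apply: (le_lt_trans (ler_normD _ _)); rewrite normrM.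
move: xe; rewrite ltr_pdivlMr//; lra.
Qed.

Lemma rdiff_swap P x0 y0 A B : rdiff P x0 y0 A B ->
  rdiff (fun y x => P x y) y0 x0 B A.
Proof.
move=> H e /H[dl dl0 {}H]; exists dl => // y x ly lx.
by have := H x y lx ly; rewrite [`|x - x0| + _]addrC addrAC.
Qed.

Lemma rdiff_conty P x0 y0 A B : rdiff P x0 y0 A B ->
  {for y0, continuous (P x0)}.
Proof. by move=> /rdiff_swap/rdiff_contx. Qed.

Definition rect_int P Q a b c d :=
  seg_int (fun x => P x c - P x d) a b + seg_int (fun y => Q b y - Q a y) c d.

(** With [P] and [Q] the real and minus the imaginary part of a holomorphic [f],
    [rect_int P Q] is the real part of the integral of [f] along the boundary,
    and the common partial derivative [B] is one Cauchy-Riemann equation.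
    Near a point the affine parts of [P] and [Q] contribute [B * (c - d)] and
    [B * (b - a)] to the integrands, and these cancel after integration, so
    only an error of second order in the size of the rectangle is left. *)
Lemma goursat P Q a b c d : a <= b -> c <= d ->
  (forall x y, a <= x <= b -> c <= y <= d ->
    exists A B C, rdiff P x y A B /\ rdiff Q x y B C) ->
  rect_int P Q a b c d = 0.
Proof.
move=> ab cd PQ.
have contP x y : a <= x <= b -> c <= y <= d -> {for x, continuous (P ^~ y)}.
  by move=> hx hy; have [A [B [C [/rdiff_contx]]]] := PQ _ _ hx hy.
have contQ x y : a <= x <= b -> c <= y <= d -> {for y, continuous (Q x)}.
  by move=> hx hy; have [A [B [C [_ /rdiff_conty]]]] := PQ _ _ hx hy.
have cP a' b' c' d' : subrect a b c d a' b' c' d' ->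
    cont_on (fun x => P x c' - P x d') a' b'.
  move=> [[h1 h2 h3 h4 h5] h6] x /andP[x1 x2].
  by apply: cvgB; apply: contP; apply/andP; split; lra.
have cQ a' b' c' d' : subrect a b c d a' b' c' d' ->
    cont_on (fun y => Q b' y - Q a' y) c' d'.
  move=> [[h1 h2 h3 h4 h5] h6] x /andP[x1 x2].
  by apply: cvgB; apply: contQ; apply/andP; split; lra.
apply: (@bisection0 _ _ a b c d) => //.
- move=> a' m b' c' d' sr /andP[am mb]; rewrite /rect_int.
  rewrite (seg_int_chasles (m := m)) ?am//; last exact: cP.
  have [[h1 h2 h3 h4 h5] h6] := sr.
  have sr1 : subrect a b c d a' m c' d' by do !split => //; lra.
  have sr2 : subrect a b c d m b' c' d' by do !split => //; lra.
  rewrite [RHS]addrACA; congr (_ + _); rewrite -seg_intD; [|exact: cQ|exact: cQ].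
  by congr seg_int; apply/funext => y; ring.
- move=> a' b' c' m d' sr /andP[am mb]; rewrite /rect_int.
  rewrite (seg_int_chasles (m := m) (a := c')) ?am//; last exact: cQ.
  have [[h1 h2 h3 h4 h5] h6] := sr.
  have sr1 : subrect a b c d a' b' c' m by do !split => //; lra.
  have sr2 : subrect a b c d a' b' m d' by do !split => //; lra.
  rewrite [RHS]addrACA; congr (_ + _).
  rewrite -seg_intD; [|exact: cP|exact: cP].
  by congr seg_int; apply/funext => y; ring.
move=> x y hx hy e e0.
have [A [B [C [dP dQ]]]] := PQ x y hx hy.
have [d1 d10 {}dP] := dP (e / 4) ltac:(lra).
have [d2 d20 {}dQ] := dQ (e / 4) ltac:(lra).
exists (Num.min d1 d2); first by rewrite lt_min d10.
move=> a' b' c' d' sr /andP[x1 x2] /andP[y1 y2]; rewrite !lt_min.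
move=> /andP[w1 w2] /andP[v1 v2].
have [[h1 h2 h3 h4 h5] h6] := sr.
set D := (b' - a') + (d' - c').
have D0 : 0 <= D by rewrite /D; lra.
have nx s : a' <= s <= b' -> `|s - x| <= b' - a'.
  by move=> /andP[s1 s2]; rewrite ler_norml; apply/andP; split; lra.
have ny s : c' <= s <= d' -> `|s - y| <= d' - c'.
  by move=> /andP[s1 s2]; rewrite ler_norml; apply/andP; split; lra.
have hc' : c' <= c' <= d' by rewrite lexx.
have hd' : c' <= d' <= d' by rewrite lexx andbT.
have ha' : a' <= a' <= b' by rewrite lexx.
have hb' : a' <= b' <= b' by rewrite lexx andbT.
have eD s t : a' <= s <= b' -> c' <= t <= d' ->
    e / 4 * (`|s - x| + `|t - y|) <= e / 4 * D.
  by move=> /nx ? /ny ?; rewrite ler_pM2l ?lerD//; lra.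
have IP := @seg_int_approx _ (fun s => P s c' - P s d') (B * (c' - d'))
  (e / 2 * D) a' b' h2 (cP _ _ _ _ sr).
have IQ := @seg_int_approx _ (fun t => Q b' t - Q a' t) (B * (b' - a'))
  (e / 2 * D) c' d' h5 (cQ _ _ _ _ sr).
have {}IP : `|seg_int (fun s => P s c' - P s d') a' b' -
    B * (c' - d') * (b' - a')| <= e / 2 * D * (b' - a').
  apply: IP => s hs.
  have := dP s c' (le_lt_trans (nx _ hs) w1) (le_lt_trans (ny _ hc') v1).
  have := dP s d' (le_lt_trans (nx _ hs) w1) (le_lt_trans (ny _ hd') v1).
  move=> /le_trans/(_ (eD _ _ hs hd')) + /le_trans/(_ (eD _ _ hs hc')).
  rewrite !ler_norml => /andP[? ?] /andP[? ?].
  by apply/andP; split; lra.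
have {}IQ : `|seg_int (fun t => Q b' t - Q a' t) c' d' -
    B * (b' - a') * (d' - c')| <= e / 2 * D * (d' - c').
  apply: IQ => t ht.
  have := dQ a' t (le_lt_trans (nx _ ha') w2) (le_lt_trans (ny _ ht) v2).
  have := dQ b' t (le_lt_trans (nx _ hb') w2) (le_lt_trans (ny _ ht) v2).
  move=> /le_trans/(_ (eD _ _ hb' ht)) + /le_trans/(_ (eD _ _ ha' ht)).
  rewrite !ler_norml => /andP[? ?] /andP[? ?].
  by apply/andP; split; lra.
have -> : rect_int P Q a' b' c' d' =
   (seg_int (fun s => P s c' - P s d') a' b' - B * (c' - d') * (b' - a'))
 + (seg_int (fun t => Q b' t - Q a' t) c' d' - B * (b' - a') * (d' - c')).
  by rewrite /rect_int; ring.
apply: (le_trans (ler_normD _ _)).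
have -> : e * D ^+ 2 = e * D * (b' - a') + e * D * (d' - c') by rewrite /D; ring.
have : 0 <= e * D * (b' - a') by rewrite !mulr_ge0 ?subr_ge0// ltW.
have : 0 <= e * D * (d' - c') by rewrite !mulr_ge0 ?subr_ge0// ltW.
lra.
Qed.
End Goursat.

(** * Integrals over the line of functions of size O(1/(1+x^2)) *)

Section whole_line.
Context {R : realType}.
Local Notation mu := (@lebesgue_measure R).
Implicit Types (g : R -> R).

Lemma integrable_oneDsqrV :
  mu.-integrable [set: R] (EFin \o (fun x : R => (oneDsqr x)^-1)).
Proof.
have c : continuous (fun x : R => (oneDsqr x)^-1) by exact: continuous_oneDsqrV.
apply/integrableP; split.
  by apply/measurable_EFinP; exact: continuous_measurable_fun.
under eq_integral.
  move=> x _; rewrite /= ger0_norm; last by rewrite invr_ge0.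
  over.
rewrite ge0_symfun_integralT//=; last first.
  by move=> x; rewrite /oneDsqr/= sqrrN.
have -> : [set x : R | 0 <= x] = `[0, +oo[%classic.
  by apply/seteqP; split => x/=; rewrite in_itv/= andbT.
by rewrite integral0y_oneDsqr -EFinM ltry.
Qed.

Lemma ae_lebesgueS (A B : R -> Prop) : (forall x, A x -> B x) ->
  {ae mu, forall x, A x} -> {ae mu, forall x, B x}.
Proof. by move=> AB; apply: (@filterS _ _ (ae_filter_ringOfSetsType mu)). Qed.

Lemma ae_lebesgueI (A B : R -> Prop) : {ae mu, forall x, A x} ->
  {ae mu, forall x, B x} -> {ae mu, forall x, A x /\ B x}.
Proof. exact: (@filterI _ _ (ae_filter_ringOfSetsType mu)). Qed.

Lemma ae_lebesgue_ex (A : R -> Prop) : {ae mu, forall x, A x} ->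
  exists x, A x.
Proof.
move=> aeA; apply: contrapT => nA.
have N01 : mu.-negligible `[0 : R, 1 : R]%classic.
  by apply: negligibleS aeA => x _ /= Ax; apply: nA; exists x.
have /eqP := iffLR (negligibleP mu (measurable_itv `[0 : R, 1 : R])) N01; rewrite /= lebesgue_measure_itv/= lte_fin ltr01.
by rewrite oppr0 adde0 eqe oner_eq0.
Qed.

Definition dominated (C : R) g := forall x, `|g x| <= C * (oneDsqr x)^-1.

Lemma dominated_ge0 C g : dominated C g -> 0 <= C.
Proof.
move=> /(_ 0); rewrite /oneDsqr expr0n/= addr0 invr1 mulr1.
exact: le_trans.
Qed.

Lemma dominated_sub C1 C2 g1 g2 : dominated C1 g1 -> dominated C2 g2 ->
  dominated (C1 + C2) (fun x => g1 x - g2 x).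
Proof.
move=> d1 d2 x; apply: (le_trans (ler_normB _ _)).
by rewrite mulrDl lerD.
Qed.

Lemma integrable_dominated C g : measurable_fun [set: R] g ->
  dominated C g -> mu.-integrable [set: R] (EFin \o g).
Proof.
move=> mg dg.
have ig := integrableZl measurableT C integrable_oneDsqrV.
apply: (le_integrable measurableT _ _ ig) => //.
  exact/measurable_EFinP.
by move=> x _ /=; rewrite lee_fin (le_trans (dg x))// ler_norm.
Qed.

(** Stated for the limit 0 so that only the [g_ n], and not their almost
    everywhere limit, have to be measurable. *)
Lemma dominated_Rintegral_cvg0 (C : R) (g_ : nat -> R -> R) :
  (forall n, measurable_fun [set: R] (g_ n)) ->
  (forall n, dominated C (g_ n)) ->
  {ae mu, forall x, g_ ^~ x @ \oo --> (0 : R)} ->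
  (fun n => \int[mu]_x g_ n x) @ \oo --> (0 : R).
Proof.
move=> mg dg cg.
have [|||||_ _] := @dominated_convergence _ _ R mu setT measurableT
  (fun n => EFin \o g_ n) (cst 0%E)
  (fun x => (C * (oneDsqr x)^-1)%:E).
- by move=> n; apply/measurable_EFinP; exact: mg.
- exact: measurable_cst.
- apply: ae_lebesgueS cg => x cx _; apply: cvg_EFin => //; exact: nearW.
- exact: (integrableZl measurableT _ integrable_oneDsqrV).
- by apply/aeW => x n _; rewrite /= lee_fin; exact: dg.
rewrite integral0 => H.
exact: (fine_cvg H).
Qed.

Lemma seg_int_cvg C g : measurable_fun [set: R] g -> dominated C g ->
  (fun n => seg_int g (- n%:R) n%:R) @ \oo --> \int[mu]_x g x.
Proof.
move=> mg dg.
have ig := integrable_dominated mg dg.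
have igr (n : nat) : mu.-integrable [set: R] (EFin \o (g \_ `[- n%:R, n%:R])).
  rewrite -restrict_EFin; apply/integrable_restrict => //.
  by rewrite setTI; apply: integrableS ig.
have -> : (fun n => seg_int g (- n%:R) n%:R) = (fun n => \int[mu]_x g x -
   \int[mu]_x (g x - (g \_ `[- n%:R, n%:R]) x)).
  apply/funext => n; rewrite RintegralB//= opprB addrC subrK.
  by rewrite /seg_int Rintegral_mkcond.
rewrite -[X in _ --> X]subr0; apply: cvgB; first exact: cvg_cst.
apply: (@dominated_Rintegral_cvg0 C).
- move=> n; apply: measurable_funB; first exact: mg.
  by apply/measurable_EFinP; exact: (measurable_int mu (igr n)).
- move=> n x; rewrite patchE; case: ifP => _; last by rewrite subr0.
  by rewrite subrr normr0 mulr_ge0 ?(dominated_ge0 dg)// invr_ge0.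
apply/aeW => x; apply/cvgrPdist_lt => e e0.
have [N xN] : exists N : nat, `|x| <= N%:R.
  exists (Num.truncn `|x|).+1; exact/ltW/truncnS_gt.
near=> n; rewrite patchE mem_set ?subrr ?subr0 ?normr0//=.
rewrite in_itv/= -ler_norml (le_trans xN)// ler_nat; near: n; exact: nbhs_infty_ge.
Unshelve. all: by end_near. Qed.

End whole_line.

(** * Contour shifts between horizontal lines *)

Section strip.
Context {R : realType}.
Local Notation mu := (@lebesgue_measure R).
Implicit Types (P Q : R -> R -> R).

(** One Cauchy-Riemann equation for [P] and [Q] on the horizontal lines with
    ordinate in [S], with a decay that is uniform in the ordinate. *)
Definition conj_pair P Q (S : set R) (C : R) := forall y, S y ->
  [/\ dominated C (P ^~ y), dominated C (Q ^~ y) &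
     forall x, exists A B D, rdiff P x y A B /\ rdiff Q x y B D].

Lemma conj_pair_measurable P Q S C y : conj_pair P Q S C -> S y ->
  measurable_fun [set: R] (P ^~ y).
Proof.
move=> PQ Sy; apply: continuous_measurable_fun => x.
by have [_ _ /(_ x)[A [B [D [/rdiff_contx]]]]] := PQ y Sy.
Qed.

(** Goursat's lemma on the rectangles [[-n, n] x [y1, y2]]: the vertical sides
    contribute O(1/(1+n^2)). *)
Lemma conj_pair_integral_eq P Q C y1 y2 : y1 <= y2 ->
  conj_pair P Q `[y1, y2] C -> \int[mu]_x P x y1 = \int[mu]_x P x y2.
Proof.
move=> y12 PQ.
have s1 : `[y1, y2]%classic y1 by rewrite /= in_itv/= lexx.
have s2 : `[y1, y2]%classic y2 by rewrite /= in_itv/= lexx y12.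
have [d1 _ _] := PQ _ s1; have [d2 _ _] := PQ _ s2.
have m1 := conj_pair_measurable PQ s1; have m2 := conj_pair_measurable PQ s2.
have C0 := dominated_ge0 d1.
apply/eqP; rewrite -subr_eq0 -RintegralB//; [|exact: integrable_dominated d1|exact: integrable_dominated d2].
have H := seg_int_cvg (measurable_funB m1 m2) (dominated_sub d1 d2).
apply/eqP; apply: (cvg_unique (@Rhausdorff R) H).
have E (n : nat) : seg_int (fun x => P x y1 - P x y2) (- n%:R) n%:R =
    - seg_int (fun y => Q n%:R y - Q (- n%:R) y) y1 y2.
  apply/eqP; rewrite -addr_eq0; apply/eqP; apply: (@goursat _ P Q) => //.
    by have : 0 <= n%:R :> R by []; lra.
  by move=> x y _ hy; have [|_ _ dd] := PQ y; rewrite /= ?in_itv.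
apply: norm_cvg0; apply: (@squeeze_cvgr _ _ _ _ (cst 0)
  (fun n => (C * 4 * (y2 - y1)) * harmonic n)).
- apply: nearW => n; rewrite normr_ge0/= E normrN.
  have := @seg_int_approx _ (fun y => Q n%:R y - Q (- n%:R) y) 0 (C * 4 * harmonic n) y1 y2 y12.
  rewrite mul0r subr0 [leRHS]mulrAC; apply.
    move=> y yy; have [|_ _ dd] := PQ y; first by rewrite /= in_itv.
    have [A [B [D [_ r1]]]] := dd n%:R; have [A' [B' [D' [_ r2]]]] := dd (- n%:R).
    by apply: cvgB; [exact: rdiff_conty r1|exact: rdiff_conty r2].
  move=> y yy; have [|_ dQ _] := PQ y; first by rewrite /= in_itv.
  rewrite subr0; apply: (le_trans (ler_normB _ _)).
  have := dQ n%:R; have := dQ (- n%:R); rewrite /oneDsqr sqrrN.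
  (* since [1 + n <= 2 * (1 + n ^ 2)] for all natural numbers [n] *)
  have : (1 + n%:R ^+ 2)^-1 <= 2 * harmonic n :> R.
    have n0 : 0 <= n%:R :> R by [].
    rewrite /harmonic/= ler_pdivlMr ?ltr0Sn// mulrC ler_pdivrMr; last by nra.
    by rewrite -natr1; nra.
  by move=> /(ler_wpM2l C0); lra.
- exact: cvg_cst.
- by rewrite -[X in _ --> X](mulr0 (C * 4 * (y2 - y1))); apply: cvgMr; exact: cvg_harmonic.
Qed.

(** The line is pushed to infinity, upwards if [s = 1] and downwards if
    [s = -1], where dominated convergence applies. *)
Lemma conj_pair_integral_eq0 P Q C (s y0 : R) : s = 1 \/ s = -1 ->
  conj_pair P Q [set y | 0 <= s * (y - y0)] C ->
  (forall x, (fun n : nat => P x (y0 + s * n%:R)) @ \oo --> (0 : R)) ->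
  \int[mu]_x P x y0 = 0.
Proof.
move=> s1 PQ P0.
have ss : s * s = 1 by case: s1 => ->; ring.
have hn (n : nat) : 0 <= s * (y0 + s * n%:R - y0).
  by rewrite addrC addKr mulrA ss mul1r.
have E (n : nat) : \int[mu]_x P x y0 = \int[mu]_x P x (y0 + s * n%:R).
  have n0 : 0 <= n%:R :> R by [].
  have sub (y1 y2 : R) : (y1 = y0 /\ s = 1) \/ (y2 = y0 /\ s = -1) ->
      conj_pair P Q `[y1, y2] C.
    move=> H y; rewrite /= in_itv/= => /andP[? ?]; apply: PQ => /=.
    by case: H => -[yE ->]; lra.
  case: s1 => sE; [|symmetry]; apply: (@conj_pair_integral_eq _ Q C); rewrite ?sE; try lra.
    by apply: sub; left.
  by apply: sub; right.
have H : (fun n : nat => \int[mu]_x P x (y0 + s * n%:R)) @ \oo --> (0 : R).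
  apply: (@dominated_Rintegral_cvg0 _ C).
  - by move=> n; apply: conj_pair_measurable PQ _; exact: hn.
  - by move=> n; have [] := PQ _ (hn n).
  - exact/aeW.
rewrite -(funext E) in H.
exact: (cvg_unique (@Rhausdorff R) (cvg_cst _) H).
Qed.
End strip.

(** * Complex differentiability in real coordinates *)

Section cdiff.
Context {R : realType}.
Local Notation C := R[i].
Local Notation normc := (@ComplexField.Normc.normc R).
Local Notation Re := (@complex.Re R).
Local Notation Im := (@complex.Im R).
Implicit Types (f : C -> C) (z w d : C).

Lemma normCE z : `|z| = (normc z)%:C.
Proof. by []. Qed.

Lemma normc_ge0 z : 0 <= normc z.
Proof. by case: z => a b; rewrite sqrtr_ge0. Qed.

Lemma sqr_normcE z : normc z ^+ 2 = Re z ^+ 2 + Im z ^+ 2.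
Proof. by case: z => a b /=; rewrite sqr_sqrtr// addr_ge0// sqr_ge0. Qed.

Lemma ler_Re_normc z : `|Re z| <= normc z.
Proof.
rewrite -(ler_pXn2r (ltn0Sn 1)) ?nnegrE ?normr_ge0 ?normc_ge0// sqr_normcE.
by rewrite real_normK ?num_real// lerDl sqr_ge0.
Qed.

Lemma ler_Im_normc z : `|Im z| <= normc z.
Proof.
rewrite -(ler_pXn2r (ltn0Sn 1)) ?nnegrE ?normr_ge0 ?normc_ge0// sqr_normcE.
by rewrite real_normK ?num_real// lerDr sqr_ge0.
Qed.

Lemma ler_normc_ReIm z : normc z <= `|Re z| + `|Im z|.
Proof.
rewrite -(ler_pXn2r (ltn0Sn 1)) ?nnegrE ?addr_ge0 ?normr_ge0 ?normc_ge0//.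
rewrite sqr_normcE sqrrD !real_normK ?num_real// addrAC lerDl.
by rewrite mulrn_wge0// mulr_ge0.
Qed.

Lemma ler_normcD z w : normc (z + w) <= normc z + normc w.
Proof. by have := ler_normD z w; rewrite !normCE -rmorphD/= lecR. Qed.

Lemma ler_normcB z w : normc (z - w) <= normc z + normc w.
Proof. by rewrite (le_trans (ler_normcD _ _))// normcN. Qed.

Lemma normcB_sym z w : normc (z - w) = normc (w - z).
Proof. by rewrite -normcN opprB. Qed.

(** Complex differentiability with real epsilons, which avoids the partial order
    of the complex numbers. *)
Definition cdiff f z d := forall e : R, 0 < e -> exists2 dl : R, 0 < dl &
  forall w, normc w < dl -> normc (f (z + w) - f z - d * w) <= e * normc w.

Lemma derivable_cdiff f z : derivable (f : C^o -> C^o) z 1 ->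
  exists d, cdiff f z d.
Proof.
move=> /cvg_ex[d /= df]; exists d => e e0.
have e0' : 0 < e%:C by rewrite ltcR.
move/cvgrPdist_lt : df => /(_ _ e0')[dl /= dl0 H].
have dlE : dl = (Re dl)%:C by rewrite RRe_real// gtr0_real.
have {dl0}dl0 : 0 < Re dl by move: dl0; rewrite dlE ltcR.
exists (Re dl) => // w wdl.
have [->|w0] := eqVneq w 0.
  by rewrite addr0 mulr0 subrr subr0 ComplexField.Normc.normc0 mulr0.
have : `|d - w^-1 *: (f (w *: (1 : C) + z) - f z)| < e%:C.
  by apply: H => //=; rewrite sub0r normrN normCE dlE ltcR.
rewrite -[w *: 1]/(w * 1) mulr1 addrC (addrC w).
rewrite -[w^-1 *: _]/(w^-1 * _) => /ltW.
have nw : 0 < `|w| by rewrite normr_gt0.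
rewrite -(ler_pM2r nw) -normrM mulrDl mulNr mulrAC mulVf// mul1r addrC -normrN.
by rewrite opprD opprK addrC !normCE -rmorphM/= lecR.
Qed.

(** Both partial derivatives called [- Im d] are the Cauchy-Riemann equation used
    by [goursat]. *)
Lemma cdiff_rdiff f x y d : cdiff f (x +i* y) d ->
  rdiff (fun x y => Re (f (x +i* y))) x y (Re d) (- Im d) /\
  rdiff (fun x y => - Im (f (x +i* y))) x y (- Im d) (- Re d).
Proof.
move=> H; have K e : 0 < e -> exists2 dl : R, 0 < dl & forall x' y',
    `|x' - x| < dl -> `|y' - y| < dl ->
    normc (f (x' +i* y') - f (x +i* y) - d * ((x' - x) +i* (y' - y)))
      <= e * (`|x' - x| + `|y' - y|).
  move=> e0; have [dl dl0 {}H] := H _ e0; exists (dl / 2); first by rewrite divr_gt0.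
  move=> x' y' hx hy.
  have := H ((x' - x) +i* (y' - y)).
  have -> : x +i* y + ((x' - x) +i* (y' - y)) = x' +i* y' :> C.
    by apply/eqP; rewrite eq_complex/= !subrKC !eqxx.
  have nn := @ler_normc_ReIm ((x' - x) +i* (y' - y)); rewrite /= in nn.
  move=> /(_ _)/le_trans; apply; last by rewrite ler_pM2l.
  by apply: (le_lt_trans nn); lra.
split=> e /K[dl dl0 {}K]; exists dl => // x' y' hx hy.
- apply: le_trans (K x' y' hx hy); apply: le_trans (ler_Re_normc _).
  rewrite le_eqVlt; apply/orP; left; apply/eqP; congr `| _ |.
  case: d {H K} => d1 d2; case: (f (x' +i* y')) => a b; case: (f (x +i* y)) => a' b' /=; ring.
- apply: le_trans (K x' y' hx hy); apply: le_trans (ler_Im_normc _).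
  rewrite le_eqVlt; apply/orP; left; apply/eqP; rewrite -normrN; congr `| _ |.
  case: d {H K} => d1 d2; case: (f (x' +i* y')) => a b; case: (f (x +i* y)) => a' b' /=; ring.
Qed.

Lemma cdiff_lip f z d : cdiff f z d -> exists2 dl : R, 0 < dl &
  forall w, normc w < dl -> normc (f (z + w) - f z) <= (normc d + 1) * normc w.
Proof.
move=> /(_ 1 ltr01)[dl dl0 H]; exists dl => // w /H; rewrite mul1r => {}H.
rewrite -[X in normc X](subrK (d * w)) (le_trans (ler_normcD _ _))//.
by rewrite ComplexField.Normc.normcM mulrDl mul1r addrC lerD2l.
Qed.
End cdiff.

(** * The kernel 1/(z-w)^2 against functions glued along the real line *)

Section kernel.
Context {R : realType}.
Local Notation C := R[i].
Local Notation mu := (@lebesgue_measure R).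
Local Notation normc := (@ComplexField.Normc.normc R).
Local Notation Re := (@complex.Re R).
Local Notation Im := (@complex.Im R).
Implicit Types (h : C -> C) (z w d : C).

Definition ker2 w z : C := ((z - w) ^+ 2)^-1.

Lemma derivable_ker2 w z : z != w ->
  derivable (ker2 w : C^o -> C^o) z 1.
Proof.
move=> zw.
have dB : derivable (fun z : C^o => (z : C^o) - (w : C^o)) z 1.
  by apply: derivableB; [exact: derivable_id|exact: derivable_cst].
apply: derivableV; first by rewrite expf_neq0// subr_eq0.
exact: (derivableM dB dB).
Qed.

Lemma normc_ker2 w (x y : R) :
  normc (ker2 w (x +i* y)) = ((x - Re w) ^+ 2 + (y - Im w) ^+ 2)^-1.
Proof.
rewrite /ker2 ComplexField.Normc.normcV; congr (_^-1).
rewrite expr2 ComplexField.Normc.normcM -expr2 sqr_normcE.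
by case: w => a b /=; rewrite !expr2.
Qed.

(** A constant for which [1 + x ^ 2] is at most [ker2_cst w r] times
    [(x - Re w) ^ 2 + r ^ 2]. *)
Definition ker2_cst w (r : R) := 2 + (2 * Re w ^+ 2 + 1) / r ^+ 2.

Lemma ker2_dominated w (r x y : R) : 0 < r -> r <= `|y - Im w| ->
  normc (ker2 w (x +i* y)) <= ker2_cst w r * (oneDsqr x)^-1.
Proof.
move=> r0 ry; rewrite normc_ker2 /ker2_cst.
set t := x - Re w; set v := y - Im w.
have r2 : 0 < r ^+ 2 by rewrite exprn_gt0.
have rv : r ^+ 2 <= v ^+ 2.
  by rewrite -[v ^+ 2]real_normK ?num_real// ler_pXn2r ?nnegrE// ltW.
have tv : 0 < t ^+ 2 + v ^+ 2 by rewrite ltr_wpDl ?sqr_ge0// (lt_le_trans r2).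
rewrite -[leLHS]mul1r ler_pdivrMr// mulrAC ler_pdivlMr ?mul1r; last first.
  by rewrite (lt_le_trans ltr01).
have -> : oneDsqr x = 1 + (t + Re w) ^+ 2 by rewrite /t subrK.
set q := (2 * Re w ^+ 2 + 1) / r ^+ 2.
have q0 : 0 <= q.
  apply: divr_ge0; last exact: ltW.
  by rewrite addr_ge0// mulr_ge0// sqr_ge0.
have qr : q * r ^+ 2 = 2 * Re w ^+ 2 + 1 by rewrite /q divfK// gt_eqF.
have : q * r ^+ 2 <= q * (t ^+ 2 + v ^+ 2).
  by rewrite ler_wpM2l// (le_trans rv)// lerDr sqr_ge0.
have := sqr_ge0 v; have := sqr_ge0 (t - Re w); nra.
Qed.


(** Agreement of the boundary values from the two half-planes is expressed by the
    jump [h (x + i y) - h (x - i y)] tending to 0, which is the quantity that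
    enters the integrals. *)
Record glued_bounded h (M : R) : Prop := GluedBounded {
  glued_derivable : forall z, Im z != 0 -> derivable (h : C^o -> C^o) z 1;
  glued_bound : forall z, Im z != 0 -> normc (h z) <= M;
  glued_jump : {ae mu, forall x, forall e : R, 0 < e ->
    exists2 dl : R, 0 < dl & forall y, y != 0 -> `|y| < dl ->
      normc (h (x +i* y) - h (x -i* y)) <= e} }.

(** [ReP] and [ImP] are the pair [(P, Q)] of [goursat] for the function
    [h * ker2 w]. *)
Definition ReP h w (x y : R) := Re (h (x +i* y) * ker2 w (x +i* y)).
Definition ImP h w (x y : R) := - Im (h (x +i* y) * ker2 w (x +i* y)).

Lemma conj_pair_ker2 h M w (r : R) (S : set R) : glued_bounded h M -> 0 < r ->
  (forall y, S y -> y != 0 /\ r <= `|y - Im w|) ->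
  conj_pair (ReP h w) (ImP h w) S (M * ker2_cst w r).
Proof.
move=> [dh bh _] r0 Sr y /Sr[y0 ry].
have M0 : 0 <= M by rewrite (le_trans (normc_ge0 _) (bh (0 +i* y) _)).
have dom x : normc (h (x +i* y) * ker2 w (x +i* y)) <= M * ker2_cst w r * (oneDsqr x)^-1.
  rewrite ComplexField.Normc.normcM -mulrA ler_pM ?normc_ge0//; first exact: bh.
  exact: ker2_dominated.
split=> [x|x|x].
- exact: le_trans (ler_Re_normc _) (dom x).
- by rewrite /ImP normrN; exact: le_trans (ler_Im_normc _) (dom x).
have [|d Hd] := @derivable_cdiff R (fun z => h z * ker2 w z) (x +i* y).
  apply: derivableM; first exact: dh.
  apply: derivable_ker2; apply: contraTneq ry => <-.
  by rewrite subrr normr0 -ltNge.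
have [d1 d2] := cdiff_rdiff Hd.
by exists (Re d), (- Im d), (- Re d).
Qed.

(** No singularity lies beyond the line: it is pushed away from both the real
    line and the pole. *)
Lemma integral_ker2_side h M w (s y0 : R) : glued_bounded h M ->
  s = 1 \/ s = -1 -> 0 < s * y0 -> 0 < s * (y0 - Im w) ->
  \int[mu]_x ReP h w x y0 = 0.
Proof.
move=> gh s1 sy sw.
have ss : s * s = 1 by case: s1 => ->; ring.
set r := s * (y0 - Im w) in sw.
have ns u : `|u| = `|s * u|.
  by rewrite normrM; case: s1 => ->; rewrite ?normrN normr1 mul1r.
have PQ : conj_pair (ReP h w) (ImP h w) [set y | 0 <= s * (y - y0)] (M * ker2_cst w r).
  apply: conj_pair_ker2 => // y /= hy; split.
    by apply: contraTneq hy => ->; rewrite -ltNge; move: sy; rewrite sub0r mulrN; lra.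
  by rewrite ns (le_trans _ (ler_norm _))// /r; lra.
apply: (conj_pair_integral_eq0 s1 PQ) => x.
have M0 : 0 <= M.
  apply: (le_trans (normc_ge0 (h (x +i* y0)))); apply: (glued_bound gh) => /=.
  by apply: contraTneq sy => ->; rewrite mulr0 ltxx.
pose B := 2 * M * ((r ^+ 2)^-1 + 1).
apply: norm_cvg0; apply: (@squeeze_cvgr _ _ _ _ (cst 0) (fun n => B * harmonic n)).
- apply: nearW => n; rewrite normr_ge0/=.
  have n0 : 0 <= n%:R :> R by [].
  have yE : s * (y0 + s * n%:R - Im w) = r + n%:R.
    by rewrite /r -[in RHS](mul1r n%:R) -ss; ring.
  have y0' : y0 + s * n%:R != 0.
    apply: contraTneq sy => E; rewrite -leNgt.
    have : s * (y0 + s * n%:R) = 0 by rewrite E mulr0.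
    by rewrite mulrDr mulrA ss mul1r; lra.
  apply: (le_trans (ler_Re_normc _)); rewrite ComplexField.Normc.normcM normc_ker2.
  have v2 : (y0 + s * n%:R - Im w) ^+ 2 = (r + n%:R) ^+ 2.
    by rewrite -yE exprMn [s ^+ 2]ss mul1r.
  rewrite v2 /B -mulrA -mulrA mulrCA ler_pM ?normc_ge0//.
  + by rewrite invr_ge0 addr_ge0 ?sqr_ge0.
  + exact: (glued_bound gh).
  set q := (r ^+ 2)^-1.
  have r2 : 0 < r ^+ 2 by rewrite exprn_gt0.
  have q0 : 0 < q by rewrite invr_gt0.
  have qr : q * r ^+ 2 = 1 by rewrite mulVf// gt_eqF.
  have D0 : 0 < (x - Re w) ^+ 2 + (r + n%:R) ^+ 2.
    by rewrite ltr_wpDl ?sqr_ge0// exprn_gt0// ltr_wpDr.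
  rewrite mulrA ler_pdivlMr ?ltr0Sn// mulrC ler_pdivrMr// -natr1.
  set t := x - Re w.
  have h1 : 0 <= q * t ^+ 2 by rewrite mulr_ge0 ?sqr_ge0// ltW.
  have h4 : 0 <= r * n%:R by rewrite mulr_ge0// ltW.
  have h2 : 0 <= q * (r * n%:R) by rewrite mulr_ge0// ltW.
  have h3 : 0 <= q * n%:R ^+ 2 by rewrite mulr_ge0 ?sqr_ge0// ltW.
  have : 1 + n%:R ^+ 2 <= (q + 1) * (t ^+ 2 + (r + n%:R) ^+ 2).
    have -> : (q + 1) * (t ^+ 2 + (r + n%:R) ^+ 2) = q * t ^+ 2 + q * r ^+ 2 +
       2 * (q * (r * n%:R)) + q * n%:R ^+ 2 + t ^+ 2 + r ^+ 2 + 2 * (r * n%:R) + n%:R ^+ 2 by ring.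
    by rewrite qr; have := sqr_ge0 t; lra.
  have : n%:R + 1 <= 2 * (1 + n%:R ^+ 2) :> R by nra.
  by lra.
- exact: cvg_cst.
- by rewrite -[X in _ --> X](mulr0 B); apply: cvgMr; exact: cvg_harmonic.
Qed.
End kernel.

Section crossing.
Context {R : realType}.
Local Notation C := R[i].
Local Notation mu := (@lebesgue_measure R).
Local Notation normc := (@ComplexField.Normc.normc R).
Local Notation Re := (@complex.Re R).
Local Notation Im := (@complex.Im R).
Implicit Types (h : C -> C) (z w d : C).

Lemma ker2_vertical_limit w (x : R) : Im w != 0 ->
  forall e : R, 0 < e -> exists2 dl : R, 0 < dl & forall y, `|y| < dl ->
    normc (ker2 w (x +i* y) - ker2 w (x +i* 0)) <= e.
Proof.
move=> w0 e e0.
have [|d /cdiff_lip[dl dl0 H]] := @derivable_cdiff R (ker2 w) (x +i* 0).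
  by apply: derivable_ker2; apply: contraNneq w0 => <-.
have k0 : 0 < normc d + 1 by rewrite ltr_wpDl ?normc_ge0.
exists (Num.min dl (e / (normc d + 1))); first by rewrite lt_min dl0 divr_gt0.
move=> y; rewrite lt_min => /andP[yd ye].
have ny : normc (0 +i* y) <= `|y|.
  by apply: (le_trans (ler_normc_ReIm _)); rewrite /= normr0 add0r.
have -> : x +i* y = x +i* 0 + (0 +i* y) :> C.
  by apply/eqP; rewrite eq_complex/= addr0 add0r !eqxx.
apply: (le_trans (H _ (le_lt_trans ny yd))).
apply: (le_trans (ler_wpM2l (ltW k0) ny)).
by rewrite mulrC -ler_pdivlMr// ltW.
Qed.

(** The line lies between the real line and the pole. It is moved towards the
    real line, across which it jumps because the jump of [h] tends to 0 almost
    everywhere; on the other side the integral is 0 by [integral_ker2_side]. *)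
Lemma integral_ker2_cross h M w (s y0 : R) : glued_bounded h M ->
  s = 1 \/ s = -1 -> 0 < s * y0 -> s * y0 < s * Im w ->
  \int[mu]_x ReP h w x y0 = 0.
Proof.
move=> gh s1 sy sw.
have ss : s * s = 1 by case: s1 => ->; ring.
have ns u : `|u| = `|s * u|.
  by rewrite normrM; case: s1 => ->; rewrite ?normrN normr1 mul1r.
set r := s * (Im w - y0).
have r0 : 0 < r by rewrite /r; lra.
have w0 : Im w != 0 by apply: contraTneq sw => ->; rewrite -leNgt mulr0 ltW.
pose S := [set y | y != 0 /\ r <= `|y - Im w|].
have PQ : conj_pair (ReP h w) (ImP h w) S (M * ker2_cst w r).
  by apply: conj_pair_ker2 => // y [].
have PQS (T : set R) : T `<=` S -> conj_pair (ReP h w) (ImP h w) T (M * ker2_cst w r).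
  by move=> TS y /TS/PQ.
have inS y : y != 0 -> s * y <= s * y0 -> S y.
  by move=> y00 sle; split=> //; rewrite ns -normrN (le_trans _ (ler_norm _))// /r; lra.
pose yn (n : nat) : R := y0 / n.+1%:R.
have invn (n : nat) : 0 < (n.+1%:R^-1 : R) <= 1.
  by rewrite invr_gt0 ltr0Sn invf_le1 ?ltr0Sn// ler1n.
have syn n : 0 < s * yn n <= s * y0.
  have /andP[i0 i1] := invn n.
  by rewrite /yn mulrA pmulr_lgt0// sy ger_pMr.
have yn0 n : yn n != 0.
  by apply/eqP => E; have := syn n; rewrite E mulr0 ltxx.
have snyn n : S (yn n) by apply: inS => //; have /andP[] := syn n.
have snynN n : S (- yn n).
  by apply: inS; rewrite ?oppr_eq0//; have /andP[] := syn n; lra.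
have up n : \int[mu]_x ReP h w x (yn n) = \int[mu]_x ReP h w x y0.
  have /andP[p1 p2] := syn n.
  case: s1 => sE.
    apply: (@conj_pair_integral_eq _ _ (ImP h w) (M * ker2_cst w r)); first by move: p2; rewrite sE; lra.
    apply: PQS => y; rewrite /= in_itv/= => /andP[i1 i2].
    apply: inS; last by rewrite sE; lra.
    by apply/eqP => E; move: p1; rewrite sE; lra.
  symmetry; apply: (@conj_pair_integral_eq _ _ (ImP h w) (M * ker2_cst w r)); first by move: p2; rewrite sE; lra.
  apply: PQS => y; rewrite /= in_itv/= => /andP[i1 i2].
  apply: inS; last by rewrite sE; lra.
  by apply/eqP => E; move: p1; rewrite sE; lra.
have down n : \int[mu]_x ReP h w x (- yn n) = 0.
  have /andP[p1 p2] := syn n.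
  apply: (@integral_ker2_side _ h M w (- s)) => //.
  - by case: s1 => ->; [right|left; rewrite opprK].
  - by rewrite mulrNN.
  - by lra.
have m y : S y -> measurable_fun [set: R] (ReP h w ^~ y).
  exact: conj_pair_measurable PQ.
have dm y : S y -> dominated (M * ker2_cst w r) (ReP h w ^~ y) by case/PQ.
have H : (fun n => \int[mu]_x (ReP h w x (yn n) - ReP h w x (- yn n))) @ \oo --> (0 : R).
  apply: (@dominated_Rintegral_cvg0 _ (M * ker2_cst w r + M * ker2_cst w r)).
  - by move=> n; apply: measurable_funB; exact: m.
  - by move=> n; apply: dominated_sub; exact: dm.
  apply: ae_lebesgueS (glued_jump gh) => x jump.
  apply/cvgrPdist_le => e e0.
  have M0 : 0 <= M.
    apply: (le_trans (normc_ge0 (h (0 +i* y0)))); apply: (glued_bound gh).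
    by apply: contraTneq sy => /= ->; rewrite mulr0 ltxx.
  set K := (r ^+ 2)^-1.
  have r2 : 0 < r ^+ 2 by rewrite exprn_gt0.
  have K0 : 0 < K by rewrite invr_gt0.
  have M20 : 0 < 4 * (M + 1) by lra.
  have [d1 d10 J] := jump (e / (2 * K)) ltac:(by rewrite divr_gt0// mulr_gt0).
  have [d2 d20 V] := ker2_vertical_limit x w0 (divr_gt0 e0 M20).
  have : yn @ \oo --> y0 * 0 by apply: cvgMr; exact: cvg_harmonic.
  rewrite mulr0 => /cvgr0Pnorm_lt Y0.
  have mind : 0 < Num.min d1 d2 by rewrite lt_min d10.
  apply: filterS (Y0 _ mind) => n; rewrite lt_min => /andP[n1 n2].
  rewrite sub0r normrN /ReP -raddfB.
  apply: (le_trans (ler_Re_normc _)).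
  set hp := h (x +i* yn n); set kp := ker2 w (x +i* yn n).
  set hm := h (x +i* - yn n); set km := ker2 w (x +i* - yn n).
  set k0 := ker2 w (x +i* 0).
  (* The jump is split into the jump of [h] and that of the kernel, which is
     continuous at the real point because its pole is not real. *)
  have -> : hp * kp - hm * km = (hp - hm) * kp + hm * ((kp - k0) - (km - k0)) by ring.
  apply: (le_trans (ler_normcD _ _)); rewrite !ComplexField.Normc.normcM.
  have b1 : normc (hp - hm) <= e / (2 * K) by apply: J.
  have b2 : normc kp <= K.
    have r2w : r ^+ 2 <= (yn n - Im w) ^+ 2.
      rewrite -[leRHS]real_normK ?num_real// ler_pXn2r ?nnegrE ?(ltW r0)//.
      by have [] := snyn n.
    have r2x : r ^+ 2 <= (x - Re w) ^+ 2 + (yn n - Im w) ^+ 2.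
      by rewrite (le_trans r2w)// lerDr sqr_ge0.
    by rewrite normc_ker2 /K lef_pV2 ?posrE// (lt_le_trans r2).
  have b3 : normc hm <= M.
    by apply: (glued_bound gh); rewrite /= oppr_eq0.
  have b4 : normc ((kp - k0) - (km - k0)) <= e / (4 * (M + 1)) + e / (4 * (M + 1)).
    by rewrite (le_trans (ler_normcB _ _))// lerD// V ?normrN.
  have c1 : normc (hp - hm) * normc kp <= e / (2 * K) * K.
    by rewrite ler_pM ?normc_ge0.
  have c2 : normc hm * normc ((kp - k0) - (km - k0)) <=
     (M + 1) * (e / (4 * (M + 1)) + e / (4 * (M + 1))).
    by rewrite ler_pM ?normc_ge0//; lra.
  rewrite (le_trans (lerD c1 c2))// le_eqVlt; apply/orP; left; apply/eqP; field.
  by rewrite (gt_eqF K0) gt_eqF//; lra.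
have HE n : \int[mu]_x (ReP h w x (yn n) - ReP h w x (- yn n)) = \int[mu]_x ReP h w x y0.
  rewrite RintegralB//; [|exact: integrable_dominated (m _ _) (dm _ _)|exact: integrable_dominated (m _ _) (dm _ _)].
  by rewrite up down subr0.
rewrite (funext HE) in H.
exact: (cvg_unique (@Rhausdorff R) (cvg_cst _) H).
Qed.

(** Contrary to Cauchy's formula, the integral does not detect whether the pole
    is above or below the line: this is where the glueing of the two half-planes
    is exploited. *)
Lemma integral_ker2 h M w (y0 : R) : glued_bounded h M ->
  Im w != 0 -> y0 != 0 -> y0 != Im w -> \int[mu]_x ReP h w x y0 = 0.
Proof.
move=> gh w0 y00 yw.
have [s s1 sy] : exists2 s : R, s = 1 \/ s = -1 & 0 < s * y0.
  move: y00; rewrite neq_lt => /orP[?|?].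
    by exists (-1); [right|rewrite mulN1r oppr_gt0].
  by exists 1; [left|rewrite mul1r].
have [lt|le] := ltP (s * y0) (s * Im w).
  exact: (integral_ker2_cross gh s1).
apply: (integral_ker2_side gh s1) => //.
rewrite mulrBr subr_gt0 lt_neqAle le andbT.
apply: contra yw => /eqP E; apply/eqP.
by case: s1 E => -> E; lra.
Qed.
End crossing.

(** * The derivative of a glued function vanishes *)

Section liouville.
Context {R : realType}.
Local Notation C := R[i].
Local Notation mu := (@lebesgue_measure R).
Local Notation normc := (@ComplexField.Normc.normc R).
Local Notation Re := (@complex.Re R).
Local Notation Im := (@complex.Im R).
Implicit Types (h : C -> C) (z w d : C).

Lemma glued_affine h M A B : glued_bounded h M ->
  glued_bounded (fun z => A * (h z - B)) (normc A * (M + normc B)).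
Proof.
move=> [dh bh jh]; split.
- move=> z z0; apply: derivableM; first exact: derivable_cst.
  by apply: derivableB; [exact: dh|exact: derivable_cst].
- move=> z z0; rewrite ComplexField.Normc.normcM ler_wpM2l ?normc_ge0//.
  by rewrite (le_trans (ler_normcB _ _))// lerD2r bh.
- apply: ae_lebesgueS jh => x jx e e0.
  have A0 : 0 < normc A + 1 by rewrite ltr_wpDl ?normc_ge0.
  have [dl dl0 H] := jx (e / (normc A + 1)) (divr_gt0 e0 A0).
  exists dl => // y y0 yd; rewrite -mulrBr opprB addrA subrK.
  rewrite ComplexField.Normc.normcM.
  apply: (@le_trans _ _ ((normc A + 1) * (e / (normc A + 1)))).
    by rewrite ler_pM ?normc_ge0 ?lerDl//; exact: H.
  by rewrite mulrC divfK// gt_eqF.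
Qed.

Lemma ker2_cst_ge0 w (r : R) : 0 <= ker2_cst w r.
Proof.
by rewrite addr_ge0// divr_ge0 ?sqr_ge0// addr_ge0// mulr_ge0// sqr_ge0.
Qed.

(** The difference of the kernels with poles just above and just below a point of
    the line is, up to a factor, the derivative of the Poisson kernel. *)
Lemma ker2_diff (s t : R) : s != 0 ->
  - 'i%C * (((t -i* s) ^+ 2)^-1 - ((t +i* s) ^+ 2)^-1) =
  (4 * s * (t / (t ^+ 2 + s ^+ 2) ^+ 2))%:C.
Proof.
move=> s0.
have D0 : (t ^+ 2 + s ^+ 2) != 0.
  by rewrite gt_eqF// ltr_wpDl ?sqr_ge0// exprn_even_gt0.
have Ni : (t -i* s) * (t +i* s) = (t ^+ 2 + s ^+ 2)%:C.
  by apply/eqP; rewrite eq_complex /=; apply/andP; split; apply/eqP; ring.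
have Dc : (t ^+ 2 + s ^+ 2)%:C != 0.
  by rewrite -[0]/(0%:C) (inj_eq (@complexI R)).
have p0 : t -i* s != 0 by apply: contraNneq Dc => E; rewrite -Ni E mul0r.
have q0 : t +i* s != 0 by apply: contraNneq Dc => E; rewrite -Ni E mulr0.
have -> : ((t -i* s) ^+ 2)^-1 - ((t +i* s) ^+ 2)^-1 =
   ((t +i* s) ^+ 2 - (t -i* s) ^+ 2) * (((t -i* s) * (t +i* s)) ^+ 2)^-1 :> C.
  by field; rewrite p0 q0.
have -> : (t +i* s) ^+ 2 - (t -i* s) ^+ 2 = 'i%C * (4 * s * t)%:C :> C.
  by rewrite !expr2; apply/eqP; rewrite eq_complex /=; apply/andP; split; apply/eqP; ring.
have ii : - 'i%C * 'i%C = 1 :> C.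
  by apply/eqP; rewrite eq_complex /=; apply/andP; split; apply/eqP; ring.
rewrite Ni !mulrA ii mul1r.
by rewrite -rmorphXn -fmorphV -rmorphM.
Qed.

(** Let [p = a + b i] and let [v] be the real part of [conjc d * (h - h p)] on the
    line of ordinate [b], so that [v (a + t)] is [m * t + o(t)] with
    [m = normc d ^ 2]. By [integral_ker2] with the poles [p + s i] and [p - s i],
    [v] is orthogonal to [t / (t ^ 2 + s ^ 2) ^ 2] for all small [s]. If [m] is
    positive, the part of the integral with [t] between [s] and [2 * s] is at
    least of order [m / s]. The rest is bounded below independently of [s], as
    the integrand is nonnegative near [a] by differentiability and dominated
    away from it. For small [s] the integral cannot be 0. *)
Lemma glued_deriv0 h M p d : glued_bounded h M -> Im p != 0 -> cdiff h p d ->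
  d = 0.
Proof.
case: p => a b gh /= b0 dh; apply/eqP/negPn/negP => d0.
set p := a +i* b in dh.
pose D := normc d; have D0 : 0 < D.
  rewrite lt_neqAle normc_ge0 andbT eq_sym; apply: contra d0 => /eqP.
  by move/ComplexField.Normc.eq0_normc ->.
pose m := D ^+ 2; have m0 : 0 < m by rewrite exprn_gt0.
pose v (x : R) := Re (conjc d * (h (x +i* b) - h p)).
have gg := glued_affine (- 'i%C * conjc d) (h p) gh.
set g := fun z => _ in gg; set M' := _ * _ in gg.
have M'E : M' = D * (M + normc (h p)).
  rewrite /M' ComplexField.Normc.normcM normcN /= expr0n /= expr1n add0r sqrtr1 mul1r.
  by rewrite /D; case: (d) => d1 d2 /=; rewrite sqrrN.
have nconj : normc (conjc d) = D.
  by rewrite /D; case: (d) => d1 d2 /=; rewrite sqrrN.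
have vbound x : `|v x| <= M'.
  rewrite M'E (le_trans (ler_Re_normc _))// ComplexField.Normc.normcM nconj.
  rewrite ler_pM2l// (le_trans (ler_normcB _ _))// lerD2r.
  exact: (glued_bound gh).
clearbody M'.
have [dl dl0 Hdl] := dh (D / 2) (divr_gt0 D0 (ltr0Sn _ 1)).
have vder t : `|t| < dl -> m / 2 * t ^+ 2 <= v (a + t) * t.
  move=> td; have := Hdl (t +i* 0).
  have nt : normc (t +i* 0) = `|t| by rewrite /= expr0n/= addr0 sqrtr_sqr.
  have -> : p + (t +i* 0) = (a + t) +i* b.
    by apply/eqP; rewrite eq_complex/= addr0 !eqxx.
  rewrite nt => /(_ td) H.
  set q := h ((a + t) +i* b) - h p - d * (t +i* 0) in H.
  have cd : conjc d * d = m%:C.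
    rewrite /m /D sqr_normcE; case: (d) => d1 d2.
    by apply/eqP; rewrite eq_complex /=; apply/andP; split; apply/eqP; ring.
  have -> : v (a + t) = Re (conjc d * q) + m * t.
    have -> : v (a + t) = Re (conjc d * q + m%:C * t%:C).
      by rewrite /v -cd /q complexr0; congr Re; ring.
    by rewrite raddfD /=; congr (_ + _); ring.
  have : `|Re (conjc d * q)| <= m / 2 * `|t|.
    apply: (le_trans (ler_Re_normc _)); rewrite ComplexField.Normc.normcM nconj.
    by apply: (le_trans (ler_wpM2l (ltW D0) H)); rewrite /m; lra.
  move=> rq; have tt : t ^+ 2 = `|t| * `|t| by rewrite -expr2 real_normK ?num_real.
  have : `|Re (conjc d * q) * t| <= m / 2 * t ^+ 2.
    by rewrite normrM tt mulrA ler_wpM2r.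
  by rewrite ler_norml => /andP[? _]; lra.
pose V (s x : R) := v x * ((x - a) / ((x - a) ^+ 2 + s ^+ 2) ^+ 2).
have intV (s : R) : 0 < s -> s < `|b| -> mu.-integrable [set: R] (EFin \o V s) /\
    \int[mu]_x V s x = 0.
  move=> s0 sb.
  pose w1 := a +i* (b + s); pose w2 := a +i* (b - s).
  have w10 : Im w1 != 0.
    by apply: contraTneq sb => /= E; rewrite (_ : b = - s) ?normrN ?gtr0_norm ?ltxx//; lra.
  have w20 : Im w2 != 0.
    by apply: contraTneq sb => /= E; rewrite (_ : b = s) ?gtr0_norm ?ltxx//; lra.
  have bw1 : b != Im w1 by apply/eqP => /= E; lra.
  have bw2 : b != Im w2 by apply/eqP => /= E; lra.
  have VE : V s = fun x => (4 * s)^-1 * (ReP g w1 x b - ReP g w2 x b).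
    apply/funext => x; apply: (mulfI (_ : 4 * s != 0)); first by rewrite gt_eqF ?mulr_gt0.
    rewrite mulVKf ?gt_eqF ?mulr_gt0//.
    rewrite /ReP -raddfB -mulrBr /ker2 /w1 /w2 /g.
    have -> : x +i* b - (a +i* (b + s)) = (x - a) -i* s :> C.
      by apply/eqP; rewrite eq_complex /=; apply/andP; split; apply/eqP; ring.
    have -> : x +i* b - (a +i* (b - s)) = (x - a) +i* s :> C.
      by apply/eqP; rewrite eq_complex /=; apply/andP; split; apply/eqP; ring.
    rewrite (mulrC (- 'i%C)) -!mulrA (mulrCA (- 'i%C)).
    rewrite ker2_diff ?gt_eqF// [conjc d * _]mulrA /V /v.
    by case: (conjc d * _) => v1 v2 /=; ring.
  have int1 (w : C) : Im w = b + s \/ Im w = b - s ->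
      mu.-integrable [set: R] (EFin \o (ReP g w ^~ b)).
    move=> wE.
    have PQ : conj_pair (ReP g w) (ImP g w) [set b] (M' * ker2_cst w s).
      apply: conj_pair_ker2 => // y ->; split=> //.
      by case: wE => ->; rewrite ler_normr; apply/orP; [right|left]; lra.
    have [dP _ _] := PQ b erefl.
    exact: (integrable_dominated (conj_pair_measurable PQ erefl) dP).
  have i1 := int1 w1 (or_introl erefl); have i2 := int1 w2 (or_intror erefl).
  have iB : mu.-integrable [set: R] (EFin \o (fun x => ReP g w1 x b - ReP g w2 x b)).
    exact: (integrableB measurableT i1 i2).
  rewrite VE; split; first exact: (integrableZl measurableT (4 * s)^-1 iB).
  by rewrite RintegralZl// RintegralB// !(integral_ker2 gg)// subrr mulr0.
pose K := M' * (2 / dl) * ker2_cst (a +i* 0) dl.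
have M'0 : 0 <= M' := le_trans (normr_ge0 _) (vbound 0).
have far (s x : R) : 0 < s -> dl <= `|x - a| -> `|V s x| <= K * (oneDsqr x)^-1.
  move=> s0 tl; rewrite /V normrM /K -!mulrA ler_pM//.
  have := @ker2_dominated R (a +i* 0) dl x dl dl0.
  rewrite normc_ker2 [Re _]/= [Im _]/= subr0 => /(_ (ler_norm _)) kd.
  have dl20 : 0 < 2 / dl by rewrite divr_gt0.
  rewrite mulrA; apply: le_trans (ler_wpM2l (ltW dl20) kd).
  have tt : (x - a) ^+ 2 = `|x - a| ^+ 2 by rewrite real_normK ?num_real.
  have E0 : 0 < (x - a) ^+ 2 + s ^+ 2 by rewrite ltr_wpDl ?sqr_ge0// exprn_gt0.
  have E1 : 0 < (x - a) ^+ 2 + dl ^+ 2 by rewrite ltr_wpDl ?sqr_ge0// exprn_gt0.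
  rewrite normrM normfV (gtr0_norm (exprn_gt0 2 E0)).
  rewrite ler_pdivrMr ?exprn_gt0//.
  have -> : 2 / dl * ((x - a) ^+ 2 + dl ^+ 2)^-1 * ((x - a) ^+ 2 + s ^+ 2) ^+ 2 =
      2 * ((x - a) ^+ 2 + s ^+ 2) ^+ 2 / (dl * ((x - a) ^+ 2 + dl ^+ 2)).
    by field; rewrite !gt_eqF.
  rewrite ler_pdivlMr ?mulr_gt0//.
  rewrite tt in E0 E1 *; set u := `|x - a| in tl E0 E1 *.
  have u0 : 0 <= u by exact: normr_ge0.
  have h1 : u * dl <= u ^+ 2 by rewrite expr2 ler_wpM2l// ltW// (lt_le_trans dl0).
  have h2 : u ^+ 2 + dl ^+ 2 <= 2 * u ^+ 2 by have : dl ^+ 2 <= u ^+ 2; [rewrite ler_pXn2r ?nnegrE// ltW|lra].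
  have h3 : u * dl * (u ^+ 2 + dl ^+ 2) <= u ^+ 2 * (2 * u ^+ 2).
    by apply: ler_pM => //; [exact: mulr_ge0 u0 (ltW dl0)|exact: ltW].
  have h4 : u ^+ 2 * u ^+ 2 <= (u ^+ 2 + s ^+ 2) ^+ 2.
    by rewrite [leRHS]expr2 ler_pM ?sqr_ge0// lerDl sqr_ge0.
  lra.
have K0 : 0 <= K by apply: mulr_ge0; [rewrite mulr_ge0// ltW// divr_gt0|exact: ker2_cst_ge0].
have near0 (s x : R) : 0 < s -> `|x - a| < dl -> 0 <= V s x.
  move=> s0 /vder; rewrite subrKC => vt; rewrite /V mulrA divr_ge0 ?sqr_ge0//.
  by rewrite (le_trans _ vt)// mulr_ge0 ?sqr_ge0// ltW// divr_gt0.
have peak (s x : R) : 0 < s -> 2 * s < dl -> a + s <= x <= a + 2 * s -> m / (50 * s ^+ 2) <= V s x.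
  move=> s0 sdl /andP[x1 x2].
  have : `|x - a| < dl by rewrite gtr0_norm; lra.
  move=> /vder; rewrite subrKC /V => vt.
  set t := x - a in vt *; have t1 : s <= t by rewrite /t; lra.
  have t2 : t <= 2 * s by rewrite /t; lra.
  have E0 : 0 < t ^+ 2 + s ^+ 2 by rewrite ltr_wpDl ?sqr_ge0// exprn_gt0.
  rewrite mulrA ler_pdivlMr ?exprn_gt0// mulrAC ler_pdivrMr; last by rewrite mulr_gt0 ?exprn_gt0.
  apply: (@le_trans _ _ (m / 2 * t ^+ 2 * (50 * s ^+ 2))); last first.
    by rewrite ler_wpM2r// mulr_ge0 ?sqr_ge0.
  have q1 : t ^+ 2 + s ^+ 2 <= 5 * (s * t) by nra.
  have q2 : (t ^+ 2 + s ^+ 2) ^+ 2 <= (5 * (s * t)) ^+ 2.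
    by rewrite ler_pXn2r ?nnegrE ?(ltW E0) ?(le_trans (ltW E0) q1).
  have -> : m / 2 * t ^+ 2 * (50 * s ^+ 2) = m * (5 * (s * t)) ^+ 2 by field.
  by rewrite ler_wpM2l ?(ltW m0).
pose I := \int[mu]_x (oneDsqr x)^-1.
have I0 : 0 <= I by apply: Rintegral_ge0 => x _; rewrite invr_ge0.
have bound (s : R) : 0 < s -> s < `|b| -> 2 * s < dl -> m / (50 * s) <= K * I.
  move=> s0 sb sdl; have [iV V0] := intV s s0 sb.
  pose c := m / (50 * s ^+ 2).
  have ic : mu.-integrable [set: R] (EFin \o ((cst c) \_ `[a + s, a + 2 * s])).
    rewrite -restrict_EFin; apply/integrable_restrict => //; rewrite setTI.
    by apply: (@seg_integrable R (cst c)) => x _; exact: cvg_cst.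
  have iK : mu.-integrable [set: R] (EFin \o (fun x => K * (oneDsqr x)^-1)).
    exact: (integrableZl measurableT K integrable_oneDsqrV).
  have : \int[mu]_x (((cst c) \_ `[a + s, a + 2 * s]) x - K * (oneDsqr x)^-1) <= \int[mu]_x V s x.
    apply: le_Rintegral => //; first exact: (integrableB measurableT ic iK).
    move=> x _; rewrite patchE; case: ifPn => [/set_mem|_].
      rewrite /= in_itv/= => /(peak s x s0 sdl); apply: le_trans.
      by rewrite gerBl mulr_ge0// invr_ge0.
    rewrite sub0r; have [xd|xd] := ltP `|x - a| dl.
      by apply: le_trans (near0 s x s0 xd); rewrite oppr_le0 mulr_ge0// invr_ge0.
    by have := far s x s0 xd; rewrite ler_norml => /andP[].
  rewrite V0 RintegralB// -Rintegral_mkcond (RintegralZl _ measurableT integrable_oneDsqrV).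
  rewrite (_ : \int[mu]_(x in _) _ = c * s); last first.
    rewrite -[LHS]/(seg_int (fun=> c) (a + s) (a + 2 * s)) seg_int_cst; last by lra.
    by congr (_ * _); ring.
  have -> : c * s = m / (50 * s) by rewrite /c; field; rewrite gt_eqF.
  by rewrite subr_le0.
have b00 : 0 < `|b| by rewrite normr_gt0.
have KI : 0 <= K * I by rewrite mulr_ge0.
(* The last bound makes [m / (50 * s)] exceed [K * I]. *)
pose s := Num.min (Num.min (`|b| / 2) (dl / 4)) (m / (100 * (K * I + 1))).
have KI1 : 0 < 100 * (K * I + 1) by lra.
have s0 : 0 < s by rewrite /s !lt_min !divr_gt0.
have s1 : s <= `|b| / 2 by rewrite /s !ge_min lexx.
have s2 : s <= dl / 4 by rewrite /s !ge_min lexx orbT.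
have s3 : s <= m / (100 * (K * I + 1)) by rewrite /s !ge_min lexx orbT.
have := bound s s0 ltac:(lra) ltac:(lra).
rewrite ler_pdivrMr ?mulr_gt0//; move: s3; rewrite ler_pdivlMr//.
nra.
Qed.
End liouville.

(** * Glued functions are constant *)

Section constant.
Context {R : realType}.
Local Notation C := R[i].
Local Notation mu := (@lebesgue_measure R).
Local Notation normc := (@ComplexField.Normc.normc R).
Local Notation Re := (@complex.Re R).
Local Notation Im := (@complex.Im R).
Implicit Types (h : C -> C) (z w d : C).

Lemma rdiff0_is_derive (P : R -> R -> R) x y : rdiff P x y 0 0 ->
  is_derive x 1 (P ^~ y) 0.
Proof.
move=> H.
have cvg0 : (fun k : R => k^-1 *: (((P ^~ y) \o shift x) (k *: (1 : R)) - P x y)) @ 0^' --> (0 : R).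
  apply/cvgrPdist_le => e e0; have [dl dl0 Hd] := H e e0.
  exists dl => //= k kd k0; rewrite sub0r normrN normrM normfV.
  rewrite /ball_/= sub0r normrN in kd.
  have nk : 0 < `|k| by rewrite normr_gt0.
  rewrite mulrC ler_pdivrMr// [k *: 1]mulr1.
  have := Hd (k + x) y; rewrite addrK subrr normr0 !mul0r !subr0 addr0.
  exact.
by apply: DeriveDef; [apply/cvg_ex; exists 0|exact: cvg_lim cvg0].
Qed.

Lemma rdiff0_const (P : R -> R -> R) x1 x2 y :
  (forall x, Num.min x1 x2 <= x <= Num.max x1 x2 -> rdiff P x y 0 0) -> P x1 y = P x2 y.
Proof.
move=> H.
wlog le12 : x1 x2 H / x1 <= x2.
  move=> W; have [|/ltW le21] := leP x1 x2; first exact: W.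
  by apply/esym/W => //; rewrite minC maxC.
rewrite min_l// max_r// in H.
have [||c _ E] := @MVT_segment R (P ^~ y) (fun=> 0) x1 x2 le12.
- move=> x; rewrite in_itv/= => /andP[/ltW a /ltW b].
  by apply: rdiff0_is_derive; apply: H; rewrite a.
- apply: continuous_in_subspaceT => x /set_mem; rewrite /= in_itv/= => /H.
  exact: rdiff_contx.
by apply/eqP; rewrite eq_sym -subr_eq0 E mul0r.
Qed.

(** The vanishing derivative makes [h] constant in each half-plane, and any real
    point with a vanishing jump shows that the two constants agree. *)
Lemma glued_const h M : glued_bounded h M ->
  exists c, forall z, Im z != 0 -> h z = c.
Proof.
move=> gh.
have rd x y : y != 0 -> rdiff (fun x y => Re (h (x +i* y))) x y 0 0 /\
    rdiff (fun x y => - Im (h (x +i* y))) x y 0 0.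
  move=> y0; have [|d dh] := @derivable_cdiff R h (x +i* y).
    exact: (glued_derivable gh).
  have d0 := glued_deriv0 (p := x +i* y) gh y0 dh; rewrite d0 in dh.
  by have := cdiff_rdiff dh; rewrite /= oppr0.
have cst (P : R -> R -> R) : (forall x y, y != 0 -> rdiff P x y 0 0) ->
    forall x1 y1 x2 y2, 0 < y1 * y2 -> P x1 y1 = P x2 y2.
  move=> rP x1 y1 x2 y2 y12.
  have y10 : y1 != 0 by apply: contraTneq y12 => ->; rewrite mul0r ltxx.
  rewrite (@rdiff0_const P x1 x2 y1); last by move=> *; exact: rP.
  apply: (@rdiff0_const (fun y x => P x y)) => y yy.
  apply: rdiff_swap; apply: rP; apply: contraTneq yy => ->.
  rewrite ge_min le_max; apply/negP => /andP[/orP[?|?] /orP[?|?]]; nra.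
have hcst x1 y1 x2 y2 : 0 < y1 * y2 -> h (x1 +i* y1) = h (x2 +i* y2).
  move=> y12; apply/eqP; rewrite eq_complex; apply/andP; split; apply/eqP.
    apply: (cst (fun x y => Re (h (x +i* y)))) y12 => x y y0.
    by have [] := rd x y y0.
  apply: oppr_inj.
  apply: (cst (fun x y => - Im (h (x +i* y)))) y12 => x y y0.
  by have [] := rd x y y0.
have [x jx] := ae_lebesgue_ex (glued_jump gh).
have same : h (0 +i* 1) = h (0 +i* -1).
  apply/eqP; rewrite -subr_eq0; apply/eqP/(@ComplexField.Normc.eq0_normc R).
  apply/eqP; rewrite eq_le normc_ge0 andbT; apply/ler_addgt0Pr => e e0.
  rewrite add0r; have [dl dl0 J] := jx e e0.
  rewrite (hcst 0 1 x (dl / 2)); last by rewrite mul1r divr_gt0.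
  rewrite (hcst 0 (-1) x (- (dl / 2))); last by rewrite mulrNN mul1r divr_gt0.
  by apply: J; [rewrite gt_eqF ?divr_gt0|rewrite gtr0_norm ?divr_gt0//; lra].
exists (h (0 +i* 1)) => -[u v] /= v0.
move: v0; rewrite neq_lt => /orP[v0|v0].
  by rewrite same; apply: hcst; rewrite mulrN1 oppr_gt0.
by apply: hcst; rewrite mulr1.
Qed.
End constant.

(** * Boundary values of bounded analytic functions *)

Section hardy.
Context {R : realType}.
Local Notation C := R[i].
Local Notation mu := (@lebesgue_measure R).
Local Notation normc := (@ComplexField.Normc.normc R).
Local Notation Re := (@complex.Re R).
Local Notation Im := (@complex.Im R).
Implicit Types (F H : C -> C) (D : set C).

Lemma ler_normc_sum (I : finType) (a : I -> C) :
  normc (\sum_i a i) <= \sum_i normc (a i).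
Proof.
elim/big_ind2: _ => [|x1 x2 y1 y2 h1 h2|i _ //].
  by rewrite ComplexField.Normc.normc0.
by rewrite (le_trans (ler_normcD _ _))// lerD.
Qed.

Lemma HinfP D F : Hinf D F <->
  (forall z, D z -> derivable (F : C^o -> C^o) z 1) /\
  exists M : R, forall z, D z -> normc (F z) <= M.
Proof.
split=> -[dF].
  move=> [M0 [M0r bF]]; split=> //; exists (Re (M0 + 1)) => z Dz.
  have := bF (M0 + 1) _ z Dz; rewrite ltrDl ltr01 => /(_ isT).
  have M1r : M0 + 1 \is Num.real by rewrite realD// real1.
  by rewrite /= normCE -[in X in _ <= X -> _](RRe_real M1r) lecR.
move=> [M bF]; split=> //; exists M%:C; split; first by rewrite complex_real.
move=> x Mx z Dz /=; apply: le_trans (ltW Mx).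
by rewrite normCE lecR; exact: bF.
Qed.

Lemma Hinf_mul D F H : Hinf D F -> Hinf D H -> Hinf D (fun z => F z * H z).
Proof.
move=> /HinfP[dF [M bF]] /HinfP[dH [N bH]]; apply/HinfP; split.
  by move=> z Dz; apply: derivableM; [exact: dF|exact: dH].
exists (M * N) => z Dz; rewrite ComplexField.Normc.normcM.
by rewrite ler_pM ?normc_ge0 ?bF ?bH.
Qed.

Lemma Hinf_sum D (n : nat) (F : 'I_n -> C -> C) :
  (forall i, Hinf D (F i)) -> Hinf D (fun z => \sum_i F i z).
Proof.
move=> hF; apply/HinfP; split.
  move=> z Dz; rewrite (_ : (fun z => _) = \sum_i (F i : C^o -> C^o)).
    by apply: derivable_sum => i; have /HinfP[dF _] := hF i; exact: dF.
  by apply/funext => w; rewrite fct_sumE.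
have /choice[M bM] : forall i, exists M : R, forall z, D z -> normc (F i z) <= M.
  by move=> i; have /HinfP[_] := hF i.
exists (\sum_i M i) => z Dz; apply: (le_trans (ler_normc_sum _)).
by apply: ler_sum => i _; exact: bM.
Qed.

Lemma Hinf_mulmx D (m n p : nat) (Phi : C -> 'M[C]_(m, n))
    (Psi : C -> 'M[C]_(n, p)) :
  Hinf_mx D Phi -> Hinf_mx D Psi -> Hinf_mx D (fun z => Phi z *m Psi z).
Proof.
move=> hPhi hPsi i j; under eq_fun do rewrite mxE.
by apply: Hinf_sum => k; exact: Hinf_mul.
Qed.

Lemma Hinf_mx_bound D (m n : nat) (Phi : C -> 'M[C]_(m, n)) : Hinf_mx D Phi ->
  exists2 M : R, 0 < M & forall z i j, D z -> normc (Phi z i j) <= M.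
Proof.
move=> hPhi.
have /choice[M bM] : forall ij : 'I_m * 'I_n, exists M : R,
    forall z, D z -> normc (Phi z ij.1 ij.2) <= M.
  by move=> ij; have /HinfP[_] := hPhi ij.1 ij.2.
exists (1 + \sum_ij `|M ij|); first by rewrite ltr_wpDr// sumr_ge0.
move=> z i j Dz; apply: (le_trans (bM (i, j) z Dz)).
rewrite (bigD1 (i, j))//= (le_trans (ler_norm _))// addrCA lerDl.
by rewrite addr_ge0// sumr_ge0.
Qed.

(** [F] tends to 0 at the real origin within [S]; used with [F y] a value at
    height [y] above or below a fixed real point. *)
Definition vanishes (S : set R) (F : R -> C) := forall e : R, 0 < e ->
  exists2 dl : R, 0 < dl & forall y, S y -> `|y| < dl -> normc (F y) <= e.

Lemma vanishesD S (F H : R -> C) : vanishes S F -> vanishes S H ->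
  vanishes S (fun y => F y + H y).
Proof.
move=> vF vH e e0; have e2 : 0 < e / 2 by rewrite divr_gt0.
have [d1 d10 h1] := vF _ e2; have [d2 d20 h2] := vH _ e2.
exists (Num.min d1 d2); first by rewrite lt_min d10.
move=> y Sy; rewrite lt_min => /andP[y1 y2].
apply: (le_trans (ler_normcD _ _)).
by have := h1 y Sy y1; have := h2 y Sy y2; lra.
Qed.

Lemma vanishes_sum S (n : nat) (F : 'I_n -> R -> C) :
  (forall i, vanishes S (F i)) -> vanishes S (fun y => \sum_i F i y).
Proof.
move=> vF; elim: n F vF => [|n IH] F vF.
  by move=> e e0; exists 1 => // y _ _; rewrite big_ord0 ComplexField.Normc.normc0 ltW.
under eq_fun do rewrite big_ord_recl.
by apply: vanishesD => //; exact: IH.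
Qed.

Lemma vanishes_mul S (M : R) (H F : R -> C) : (forall y, S y -> normc (H y) <= M) ->
  vanishes S F -> vanishes S (fun y => H y * F y).
Proof.
move=> bH vF e e0; have M0 : 0 < `|M| + 1 by rewrite ltr_wpDl.
have [dl dl0 h] := vF _ (divr_gt0 e0 M0); exists dl => // y Sy yd.
rewrite ComplexField.Normc.normcM.
apply: (@le_trans _ _ ((`|M| + 1) * (e / (`|M| + 1)))).
  rewrite ler_pM ?normc_ge0//; last exact: h.
  by rewrite (le_trans (bH y Sy))// (le_trans (ler_norm M))// lerDl.
by rewrite mulrC divfK// gt_eqF.
Qed.

Lemma vanishes_mulmx S (m n : nat) (M : R) (H : R -> 'M[C]_(m, n))
    (F : R -> 'cV[C]_n) (B : 'M[C]_(m, n)) (u : 'cV[C]_n) :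
  (forall y i j, S y -> normc (H y i j) <= M) ->
  (forall i j, vanishes S (fun y => H y i j - B i j)) ->
  (forall j, vanishes S (fun y => F y j 0 - u j 0)) ->
  forall i, vanishes S (fun y => (H y *m F y) i 0 - (B *m u) i 0).
Proof.
move=> bH vH vF i.
rewrite (_ : (fun y => _) = fun y => \sum_k (H y i k * (F y k 0 - u k 0) +
    u k 0 * (H y i k - B i k))); last first.
  by apply/funext => y; rewrite !mxE -sumrB; apply: eq_bigr => k _; ring.
apply: vanishes_sum => k; apply: vanishesD.
  by apply: (@vanishes_mul _ M) => // y; exact: bH.
exact: (@vanishes_mul _ (normc (u k 0))).
Qed.

(** The error is the bounded matrix [invmx (E y)] applied to [F y - E y *m b],
    which tends to 0. *)
Lemma vanishes_invmx_mul S (n : nat) (M : R) (E : R -> 'M[C]_n)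
    (F : R -> 'cV[C]_n) (A : 'M[C]_n) (b : 'cV[C]_n) :
  (forall y, S y -> E y \in unitmx) ->
  (forall y i j, S y -> normc (invmx (E y) i j) <= M) ->
  (forall i j, vanishes S (fun y => E y i j - A i j)) ->
  (forall j, vanishes S (fun y => F y j 0 - (A *m b) j 0)) ->
  forall i, vanishes S (fun y => (invmx (E y) *m F y) i 0 - b i 0).
Proof.
move=> uE bE vE vF i.
have resid k : vanishes S (fun y => (F y - E y *m b) k 0).
  rewrite (_ : (fun y => _) = fun y => (F y k 0 - (A *m b) k 0) +
      \sum_l (- b l 0) * (E y k l - A k l)); last first.
    apply/funext => y; rewrite !mxE -!addrA; congr (_ + _).
    rewrite -sumrN -[X in _ = X + _]sumrN -big_split.
    by apply: eq_bigr => l _ /=; ring.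
  apply: vanishesD => //; apply: vanishes_sum => l.
  exact: (@vanishes_mul _ (normc (- b l 0))).
have : vanishes S (fun y => \sum_k invmx (E y) i k * (F y - E y *m b) k 0).
  apply: vanishes_sum => k; apply: (@vanishes_mul _ M) => // y; exact: bE.
move=> vs e /vs[dl dl0 H]; exists dl => // y Sy yd.
have := H y Sy yd; congr (normc _ <= _).
transitivity ((invmx (E y) *m (F y - E y *m b)) i 0); first by rewrite [RHS]mxE.
by rewrite mulmxBr mulKmx ?uE// mxE [(- b) _ _]mxE.
Qed.

(** Vertical approach stays in the sector of opening 1. *)
Lemma boundary_value_vertical D F (x : R) l : boundary_value D F x l ->
  vanishes [set y | y != 0 /\ D (x +i* y)] (fun y => F (x +i* y) - l).
Proof.
move=> /(_ 1 ltr01) bv e e0.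
have nb : nbhs (l : C^o) [set w | `|l - w| < e%:C].
  by apply/nbhs_ballP; exists e%:C => //=; rewrite ltcR.
have /nbhs_ballP[dl /= dl0 H] := bv _ nb.
have dlE : dl = (Re dl)%:C by rewrite RRe_real// gtr0_real.
have {dl0}dl0 : 0 < Re dl by move: dl0; rewrite dlE ltcR.
exists (Re dl) => // y [y0 Dy] yd.
have := H (x +i* y); rewrite /ball/= => Hy; rewrite normcB_sym ltW// -ltcR -normCE; apply: Hy.
  have -> : x%:C - (x +i* y) = 0 +i* - y :> C.
    by apply/eqP; rewrite eq_complex /= subrr sub0r !eqxx.
  rewrite normCE dlE ltcR; apply: le_lt_trans yd.
  by apply: (le_trans (ler_normc_ReIm _)); rewrite /= normr0 add0r normrN.
by split=> //=; rewrite subrr normr0 mul1r normr_gt0.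
Qed.

Lemma near_Im_gt0 (z : C) : 0 < Im z -> \forall w \near (z : C^o), 0 < Im w.
Proof.
move=> z0; apply/nbhs_ballP; exists (Im z)%:C => /=; first by rewrite ltcR.
move=> w; rewrite /ball/= normCE ltcR => zw.
have := le_lt_trans (ler_Im_normc _) zw; rewrite raddfB/= ltr_norml => /andP[_].
lra.
Qed.

Lemma near_Im_lt0 (z : C) : Im z < 0 -> \forall w \near (z : C^o), Im w < 0.
Proof.
move=> z0; apply/nbhs_ballP; exists (- Im z)%:C => /=; first by rewrite ltcR oppr_gt0.
move=> w; rewrite /ball/= normCE ltcR => zw.
have := le_lt_trans (ler_Im_normc _) zw; rewrite raddfB/= ltr_norml => /andP[+ _].
lra.
Qed.

(** Liouville's theorem across the real line, for boundary values that agree only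
    almost everywhere. *)
Lemma glued_boundary_const (Fp Fm : C -> C) :
  Hinf (@upper_half_plane R) Fp -> Hinf (@lower_half_plane R) Fm ->
  {ae mu, forall x, exists l,
    vanishes [set y | y != 0 /\ upper_half_plane (x +i* y)] (fun y => Fp (x +i* y) - l) /\
    vanishes [set y | y != 0 /\ lower_half_plane (x +i* y)] (fun y => Fm (x +i* y) - l)} ->
  exists c, (forall z, upper_half_plane z -> Fp z = c) /\
            (forall z, lower_half_plane z -> Fm z = c).
Proof.
move=> /HinfP[dp [Mp bp]] /HinfP[dm [Mm bm]] bv.
pose h z := if 0 < Im z then Fp z else Fm z.
have hp z : 0 < Im z -> h z = Fp z by rewrite /h => ->.
have hm z : Im z < 0 -> h z = Fm z by move=> z0; rewrite /h ltNge ltW.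
have gh : glued_bounded h (Num.max Mp Mm).
  split.
  - move=> z; rewrite neq_lt => /orP[z0|z0].
      apply: near_eq_derivable (dm z z0).
      by apply: filterS (near_Im_lt0 z0) => w /hm.
    apply: near_eq_derivable (dp z z0).
    by apply: filterS (near_Im_gt0 z0) => w /hp.
  - move=> z; rewrite neq_lt le_max => /orP[z0|z0].
      by rewrite hm// bm// orbT.
    by rewrite hp// bp.
  - apply: ae_lebesgueS bv => x [l [vp vm]] e e0.
    have e2 : 0 < e / 2 by rewrite divr_gt0.
    have [d1 d10 h1] := vp _ e2; have [d2 d20 h2] := vm _ e2.
    exists (Num.min d1 d2); first by rewrite lt_min d10.
    have key y : 0 < y -> y < d1 -> y < d2 -> normc (h (x +i* y) - h (x -i* y)) <= e.
      move=> y0 y1 y2; rewrite hp// hm; last by rewrite /= oppr_lt0.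
      have H1 : normc (Fp (x +i* y) - l) <= e / 2.
        by apply: h1; [split=> //; rewrite gt_eqF|rewrite gtr0_norm].
      have H2 : normc (Fm (x -i* y) - l) <= e / 2.
        apply: h2; last by rewrite normrN gtr0_norm.
        by split; rewrite /lower_half_plane/= ?oppr_lt0// oppr_eq0 gt_eqF.
      rewrite (_ : _ - _ = (Fp (x +i* y) - l) - (Fm (x -i* y) - l)); last by ring.
      by apply: (le_trans (ler_normcB _ _)); lra.
    move=> y; rewrite neq_lt lt_min => /orP[y0|y0] /andP[y1 y2].
      rewrite normcB_sym -{2}(opprK y); apply: key; rewrite ?oppr_gt0//.
        by rewrite -(ltr0_norm y0).
      by rewrite -(ltr0_norm y0).
    by rewrite gtr0_norm// in y1 y2; exact: key.
have [c hc] := glued_const gh; exists c; split=> z z0.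
  by rewrite -hp// hc// gt_eqF.
by rewrite -hm// hc// lt_eqF.
Qed.

(** A vector function that a bounded matrix function sends to a fixed nonzero
    vector cannot come close to 0. *)
Lemma corona_of_linear D (n : nat) (E : C -> 'M[C]_n) (w : C -> 'cV[C]_n)
    (c : 'cV[C]_n) : D !=set0 -> Hinf_mx D E -> c != 0 ->
  (forall z, D z -> E z *m w z = c) -> corona D w.
Proof.
move=> [z0 Dz0] hE c0 Ec.
have [M M0 bM] := Hinf_mx_bound hE.
have [j cj] : exists j, c j 0 != 0.
  apply: contrapT => nc; move/eqP: c0; apply; apply/matrixP => i k.
  rewrite ord1 mxE; apply/eqP/negPn/negP => ci; apply: nc; by exists i.
have nj : 0 < normc (c j 0).
  rewrite lt_neqAle normc_ge0 andbT eq_sym; apply: contra cj => /eqP.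
  by move/ComplexField.Normc.eq0_normc ->.
apply: (@lt_le_trans _ _ (normc (c j 0) / M)); first by rewrite divr_gt0.
apply: lb_le_inf; first by exists (\sum_(i < n) normc (w z0 i 0)), z0.
move=> _ [z Dz <-]; rewrite ler_pdivrMr// -(Ec z Dz) mxE mulr_suml.
apply: (le_trans (ler_normc_sum _)); apply: ler_sum => i _.
by rewrite ComplexField.Normc.normcM mulrC ler_wpM2l ?normc_ge0// bM.
Qed.
End hardy.

Theorem theorem2p8 (R : realType) (n : nat) (G : R -> 'M[R[i]]_n)
    (hG : admits_bounded_canonical_factorization G)
    (phip phim : R[i] -> 'cV[R[i]]_n)
    (hphi : RH_solution G phip phim)
    (hnt : ~ trivial_solution phip phim) :
  corona (@upper_half_plane R) phip /\ corona (@lower_half_plane R) phim.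
Proof.
case: hG => Gm [Gp [[up hp hpi] [um hm hmi] fac]].
case: hphi => sp sm sol.
have hup := Hinf_mulmx hpi sp; have hum := Hinf_mulmx hmi sm.
(* On the real line [G *m phip = phim] reads
   [invmx Gp *m phip = invmx Gm *m phim]. *)
have const j : exists c, (forall z, upper_half_plane z -> (invmx (Gp z) *m phip z) j 0 = c) /\
    (forall z, lower_half_plane z -> (invmx (Gm z) *m phim z) j 0 = c).
  apply: glued_boundary_const; [exact: hup|exact: hum|].
  apply: ae_lebesgueS (ae_lebesgueI fac sol) => x [[A [B [bA bB ->]]] [u [v [bu bv E]]]].
  exists ((B *m u) j 0); split.
    have [M _ bM] := Hinf_mx_bound hpi.
    apply: (@vanishes_mulmx _ _ _ _ M) => [y i k [_ ?]|i k|k]; first exact: bM.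
      exact: boundary_value_vertical (bB i k).
    exact: boundary_value_vertical (bu k 0).
  have [M _ bM] := Hinf_mx_bound hmi.
  apply: (@vanishes_invmx_mul _ _ _ M _ _ A) => [y [_]|y i k [_ ?]|i k|k].
  - exact: um.
  - exact: bM.
  - exact: boundary_value_vertical (bA i k).
  - rewrite mulmxA E; exact: boundary_value_vertical (bv k 0).
have /choice[c hc] := const.
pose cv : 'cV[R[i]]_n := \col_j c j.
have cp z : upper_half_plane z -> invmx (Gp z) *m phip z = cv.
  by move=> Dz; apply/matrixP => j k; rewrite ord1 [RHS]mxE; have [-> ] := hc j.
have cm z : lower_half_plane z -> invmx (Gm z) *m phim z = cv.
  by move=> Dz; apply/matrixP => j k; rewrite ord1 [RHS]mxE; have [_ ->] := hc j.
have cv0 : cv != 0.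
  apply/eqP => c0; apply: hnt; split=> z Dz.
    by rewrite -(mulKVmx (up z Dz) (phip z)) cp// c0 mulmx0.
  by rewrite -(mulKVmx (um z Dz) (phim z)) cm// c0 mulmx0.
split.
  apply: corona_of_linear hpi cv0 cp.
  by exists (0 +i* 1); rewrite /upper_half_plane/=.
apply: corona_of_linear hmi cv0 cm.
by exists (0 +i* (-1)); rewrite /lower_half_plane/= oppr_lt0.
Qed.
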